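(* For every $\epsilon>0$ there is a $(1+\epsilon)$-approximation algorithm for \textsc{MinSum Retrieval} on bidirectional trees with $n$ vertices that runs in time polynomial in $n$ and $1/\epsilon$; that is, it outputs a solution of storage cost at most $\mathcal{S}$ whose total retrieval cost is at most $(1+\epsilon)$ times the minimum possible.
   Context: A version graph is a directed graph $G=(V,E)$ in which every vertex $v$ has a materialization (storage) cost $s_v\in\mathbb{N}$ and every edge $e=(u,v)$ has a storage cost $s_e\in\mathbb{N}$ and a retrieval cost $r_e\in\mathbb{N}$. A solution consists of a set $M\subseteq V$ of materialized vertices and a set $F\subseteq E$ of stored edges such that every vertex is reachable from some vertex of $M$ by a directed path (possibly of length $0$) with all edges in $F$. Its storage cost is $\sum_{v\in M}s_v+\sum_{e\in F}s_e$; the retrieval cost $R(v)$ is the minimum, over such paths, of the sum of the $r_e$ on the path ($0$ for $v\in M$). \textsc{MinSum Retrieval}: given $G$ and a storage bound $\mathcal{S}$, minimize $\sum_vR(v)$ over solutions of storage cost $\le\mathcal{S}$. A bidirectional tree is a version graph obtained from an undirected tree $(V,E_0)$ by including both directed edges $(u,v)$ and $(v,u)$ for each $\{u,v\}\in E_0$, where the costs of the two directions may differ. *)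

(* Defs.v *)
From mathcomp Require Import all_boot all_algebra.
From mathcomp Require Import classical_sets reals.
Set Implicit Arguments.
Unset Strict Implicit.
Unset Printing Implicit Defensive.

(* The values of [edge_store] and [edge_ret] on pairs that are not edges are
   junk: neither solutions nor the input encoding ever use them. *)
Record version_graph (V : finType) := VersionGraph {
  edge : rel V;
  vertex_store : V -> nat;
  edge_store : V -> V -> nat;
  edge_ret : V -> V -> nat }.

Section Solutions.
Variables (V : finType) (G : version_graph V).
Implicit Types (M : {set V}) (F : {set V * V}).

(* The directed path visiting [x :: p] starts in [M], ends at [v] and uses only
   edges of [F]; [p] is empty for the path of length 0. *)
Definition retrieval_path M F (v x : V) (p : seq V) : Prop :=
  [/\ x \in M, path (fun a b => (a, b) \in F) x p & last x p = v].

(* [pairmap f x p] lists the values of [f] on consecutive vertices of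
   [x :: p], i.e. on the edges of the path. *)
Definition path_cost (x : V) (p : seq V) : nat :=
  sumn (pairmap (edge_ret G) x p).

Definition solution M F : Prop :=
  {subset F <= [pred e | edge G e.1 e.2]} /\
  forall v, exists x p, retrieval_path M F v x p.

Definition storage_cost M F : nat :=
  \sum_(v in M) vertex_store G v + \sum_(e in F) edge_store G e.1 e.2.

Definition is_retrieval_cost M F (v : V) (k : nat) : Prop :=
  (exists x p, retrieval_path M F v x p /\ path_cost x p = k) /\
  (forall x p, retrieval_path M F v x p -> k <= path_cost x p).

(* The minimum exists (and is unique) as soon as some retrieval path to [v]
   does; the default value 0 is never used for solutions. *)
Definition retrieval_cost M F (v : V) : nat :=
  xget 0 (is_retrieval_cost M F v).

Definition total_retrieval M F : nat := \sum_(v : V) retrieval_cost M F v.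

Definition feasible (S : nat) M F : Prop :=
  solution M F /\ storage_cost M F <= S.

End Solutions.

Definition undirected_tree (V : finType) (e : rel V) : Prop :=
  [/\ 0 < #|V|, symmetric e, irreflexive e, forall x y, connect e x y &
      forall c : seq V, 2 < size c -> ~ ucycle e c].

(* Replacing each undirected edge by its two orientations leaves the adjacency
   relation unchanged; the costs of the two orientations are unrelated. *)
Definition bidirectional_tree (V : finType) (G : version_graph V) : Prop :=
  undirected_tree (edge G).

(* A strict first-order functional language in the style of pure LISP, on data
   built from natural numbers by pairing. Each evaluation step costs one. A
   step is a bounded number of operations on pointers and registers, so running
   times agree, up to a polynomial, with those of a random access machine with
   unit-cost addition, subtraction and comparison. Multiplication and division
   are deliberately not primitive: unit-cost multiplication would let t steps
   produce numbers with exponentially many digits in t. *)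

Inductive value :=
| VNat of nat
| VPair of value & value.

(* [Var i] is the i-th entry of the environment and [Let] pushes onto it.
   [Call f a] runs the f-th function of the program in the environment whose
   only entry is the value of [a]. *)
Inductive expr :=
| Var of nat
| Const of nat
| Add of expr & expr
| Sub of expr & expr
| Pair of expr & expr
| Fst of expr
| Snd of expr
| If of expr & expr & expr
| Let of expr & expr
| Call of nat & expr.

(* A finite, possibly mutually recursive, list of function bodies; function 0
   is the entry point. *)
Definition program := seq expr.

(* [eval A env e v t]: in [env], [e] evaluates to [v] in exactly [t] steps.
   Ill-typed operations and nonterminating computations have no derivation. *)
Inductive eval (A : program) : seq value -> expr -> value -> nat -> Prop :=
| EVar env i v :
    onth env i = Some v -> eval A env (Var i) v 1
| EConst env c :
    eval A env (Const c) (VNat c) 1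
| EAdd env e1 e2 m n t1 t2 :
    eval A env e1 (VNat m) t1 -> eval A env e2 (VNat n) t2 ->
    eval A env (Add e1 e2) (VNat (m + n)) (t1 + t2).+1
| ESub env e1 e2 m n t1 t2 :
    eval A env e1 (VNat m) t1 -> eval A env e2 (VNat n) t2 ->
    eval A env (Sub e1 e2) (VNat (m - n)) (t1 + t2).+1
| EPair env e1 e2 v1 v2 t1 t2 :
    eval A env e1 v1 t1 -> eval A env e2 v2 t2 ->
    eval A env (Pair e1 e2) (VPair v1 v2) (t1 + t2).+1
| EFst env e v1 v2 t :
    eval A env e (VPair v1 v2) t -> eval A env (Fst e) v1 t.+1
| ESnd env e v1 v2 t :
    eval A env e (VPair v1 v2) t -> eval A env (Snd e) v2 t.+1
| EIfZero env e e1 e2 v t t2 :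
    eval A env e (VNat 0) t -> eval A env e2 v t2 ->
    eval A env (If e e1 e2) v (t + t2).+1
| EIfNonzero env e e1 e2 w v t t1 :
    eval A env e w t -> w <> VNat 0 -> eval A env e1 v t1 ->
    eval A env (If e e1 e2) v (t + t1).+1
| ELet env e1 e2 v1 v2 t1 t2 :
    eval A env e1 v1 t1 -> eval A (v1 :: env) e2 v2 t2 ->
    eval A env (Let e1 e2) v2 (t1 + t2).+1
| ECall env f a b u v t1 t2 :
    eval A env a u t1 -> onth A f = Some b -> eval A [:: u] b v t2 ->
    eval A env (Call f a) v (t1 + t2).+1.

Definition runs (A : program) (x y : value) (t : nat) : Prop :=
  eval A [:: x] (Call 0 (Var 0)) y t.

(* [eval] is deterministic, so "there is a run" means "the run". *)
Lemma eval_det A env e v t v' t' :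
  eval A env e v t -> eval A env e v' t' -> v = v' /\ t = t'.
Proof.
move=> H; elim: H v' t' => {env e v t}.
- by move=> env i v Hi v' t' H; inversion H; split=> //; congruence.
- by move=> env c v' t' H; inversion H.
- move=> env e1 e2 m n t1 t2 _ IH1 _ IH2 v' t' H.
  inversion H as [| |? ? ? ? ? ? ? H1 H2| | | | | | | |]; subst.
  by case: (IH1 _ _ H1) => -[->] ->; case: (IH2 _ _ H2) => -[->] ->.
- move=> env e1 e2 m n t1 t2 _ IH1 _ IH2 v' t' H.
  inversion H as [| | |? ? ? ? ? ? ? H1 H2| | | | | | |]; subst.
  by case: (IH1 _ _ H1) => -[->] ->; case: (IH2 _ _ H2) => -[->] ->.
- move=> env e1 e2 v1 v2 t1 t2 _ IH1 _ IH2 v' t' H.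
  inversion H as [| | | |? ? ? ? ? ? ? H1 H2| | | | | |]; subst.
  by case: (IH1 _ _ H1) => -> ->; case: (IH2 _ _ H2) => -> ->.
- move=> env e v1 v2 t _ IH v' t' H.
  inversion H as [| | | | |? ? ? ? ? H1| | | | |]; subst.
  by case: (IH _ _ H1) => -[-> _] ->.
- move=> env e v1 v2 t _ IH v' t' H.
  inversion H as [| | | | | |? ? ? ? ? H1| | | |]; subst.
  by case: (IH _ _ H1) => -[_ ->] ->.
- move=> env e e1 e2 v t t2 _ IH _ IH2 v' t' H.
  inversion H as [| | | | | | |? ? ? ? ? ? ? H1 H2
                 |? ? ? ? ? ? ? ? H1 N H2| |]; subst.
    by case: (IH _ _ H1) => _ ->; case: (IH2 _ _ H2) => -> ->.
  by case: (IH _ _ H1) => W; case: N.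
- move=> env e e1 e2 w v t t1 _ IH N _ IH1 v' t' H.
  inversion H as [| | | | | | |? ? ? ? ? ? ? H1 H2
                 |? ? ? ? ? ? ? ? H1 N' H2| |]; subst.
    by case: (IH _ _ H1) => W; case: N.
  by case: (IH _ _ H1) => _ ->; case: (IH1 _ _ H2) => -> ->.
- move=> env e1 e2 v1 v2 t1 t2 _ IH1 _ IH2 v' t' H.
  inversion H as [| | | | | | | | |? ? ? ? ? ? ? H1 H2|]; subst.
  by case: (IH1 _ _ H1) => W ->; subst; case: (IH2 _ _ H2) => -> ->.
- move=> env f a b u v t1 t2 _ IH1 Hf _ IH2 v' t' H.
  inversion H as [| | | | | | | | | |? ? ? ? ? ? ? ? H1 Hf' H2]; subst.
  case: (IH1 _ _ H1) => W ->; subst.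
  have W : b = b0 by congruence.
  by subst; case: (IH2 _ _ H2) => -> ->.
Qed.

Definition enc_list (s : seq value) : value := foldr VPair (VNat 0) s.

Section Encoding.
Variable n : nat.

Definition enc_edge (e : 'I_n * 'I_n) : value := VPair (VNat e.1) (VNat e.2).

(* The edges in lexicographic order. *)
Definition edge_list (G : version_graph 'I_n) : seq ('I_n * 'I_n) :=
  [seq e <- [seq (u, v) | u <- enum 'I_n, v <- enum 'I_n] | edge G e.1 e.2].

(* The input (n, (S, (vertex costs, edges))), an edge being listed as
   ((u, v), (storage cost, retrieval cost)). *)
Definition enc_instance (G : version_graph 'I_n) (S : nat) : value :=
  VPair (VNat n) (VPair (VNat S) (VPair
    (enc_list [seq VNat (vertex_store G v) | v <- enum 'I_n])
    (enc_list [seq VPair (enc_edge e)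
                (VPair (VNat (edge_store G e.1 e.2))
                       (VNat (edge_ret G e.1 e.2))) | e <- edge_list G]))).

(* An output lists, in any order, the materialized vertices and the stored
   edges. *)
Definition encodes_output (w : value) (M : {set 'I_n}) (F : {set 'I_n * 'I_n})
    : Prop :=
  exists (sM : seq 'I_n) (sF : seq ('I_n * 'I_n)),
    [/\ w = VPair (enc_list [seq VNat (nat_of_ord v) | v <- sM])
                  (enc_list [seq enc_edge e | e <- sF]),
        M =i sM & F =i sF].

End Encoding.

Local Open Scope ring_scope.

(* A storage bound may admit no solution at all; then the output is
   unconstrained, since there is no minimum to compare with. *)
Definition approximates (R : realType) (eps : R) n (G : version_graph 'I_n)
    (S : nat) (w : value) : Prop :=
  (exists M F, feasible G S M F) ->
  exists M F, [/\ encodes_output w M F, feasible G S M F &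
    forall M' F', feasible G S M' F' ->
      (total_retrieval G M F)%:R <=
        (1 + eps) * (total_retrieval G M' F')%:R].

(* Main.v *)
Require Import Defs.
From mathcomp Require Import all_boot all_order all_algebra.
From mathcomp Require Import reals zify lra.
From mathcomp Require classical_sets boolp.
Set Implicit Arguments.
Unset Strict Implicit.
Unset Printing Implicit Defensive.

(* Retrieval from the materialized vertices is a flow: with N v the number of
   vertices retrieved through v, the total retrieval cost is the sum of the terms
   N v * r(par v, v), where par v is the vertex that v is retrieved from. Guess
   the largest term B of an optimal solution among the polynomially many products
   j * r_e with 1 <= j <= n (and 0). As OPT >= B, scaling each term by Q / B with
   Q = n * k and rounding loses at most a factor 1 + 1/k, while the rounded costs
   are at most n * Q. The cheapest storage for each rounded cost is found by a
   dynamic program that eliminates leaves of the tree one by one; all that the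
   rest of the tree sees of an eliminated part is the amount of flow through its
   last vertex. No step depends on the size of the numbers of the instance, so
   the running time is polynomial in n and k alone. *)

(** * The cost semantics *)

(** The exact cost takes no part in the pruning, which keeps one candidate of least storage per key.
    This is harmless because soundness and completeness meet only in the rounded cost. Soundness
    holds for every [B] and [Q]: [comb] discards terms above [B], and rounding down loses at most
    one unit per attachment, so that a candidate on the whole tree has
    [Q * cost + B <= B * (rho + n)]. Thus a wrong guess never yields a wrong solution, and the
    candidates of all guesses can be compared by exact cost. Completeness makes no claim on costs:
    for the right [B] it finds, under the key that an optimal solution induces, some candidate of no
    larger storage. There [B * rho <= Q * OPT], so the cost is at most
    [OPT + n * B / Q = OPT + B / k].

    The source of a vertex may lie in a part that is attached much later. Therefore a materialized
    vertex guesses its flow in advance, and any other vertex starts with supply 0 until an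
    attachment brings a surplus or passes its demand on. *)

Definition ev (A : program) env e v b := exists2 t, t <= b & eval A env e v t.

Section Evaluation.
Variable A : program.
Notation ev := (ev A).

Lemma ev_le env e v b b' : ev env e v b -> b <= b' -> ev env e v b'.
Proof. by case=> t tb H bb; exists t => //; apply: leq_trans bb. Qed.

(** Without conditionals, bindings and calls the cost depends on the expression alone, so such code
    is checked by computing [peval] instead of building a derivation. *)
Fixpoint peval (env : seq value) (e : expr) : option value :=
  match e with
  | Var i => onth env i
  | Const c => Some (VNat c)
  | Add e1 e2 =>
      match peval env e1, peval env e2 with
      | Some (VNat m), Some (VNat n) => Some (VNat (m + n))
      | _, _ => None
      end
  | Defs.Sub e1 e2 =>
      match peval env e1, peval env e2 with
      | Some (VNat m), Some (VNat n) => Some (VNat (m - n))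
      | _, _ => None
      end
  | Pair e1 e2 =>
      match peval env e1, peval env e2 with
      | Some v1, Some v2 => Some (VPair v1 v2)
      | _, _ => None
      end
  | Fst e => if peval env e is Some (VPair v _) then Some v else None
  | Snd e => if peval env e is Some (VPair _ v) then Some v else None
  | _ => None
  end.

Fixpoint esize (e : expr) : nat :=
  match e with
  | Add e1 e2 | Defs.Sub e1 e2 | Pair e1 e2 => (Nat.add (esize e1) (esize e2)).+1
  | Fst e | Snd e => (esize e).+1
  | _ => 1
  end.

Lemma ev_pure env e v : peval env e = Some v -> ev env e v (esize e).
Proof.
move=> H; exists (esize e) => //.
elim: e v H => //=.
- by move=> i v; apply: EVar.
- by move=> c v [<-]; apply: EConst.
- move=> e1 IH1 e2 IH2 v; case: peval IH1 => // -[m|//] IH1.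
  case: peval IH2 => // -[p|//] IH2 [<-].
  by apply: EAdd; [apply: IH1 | apply: IH2].
- move=> e1 IH1 e2 IH2 v; case: peval IH1 => // -[m|//] IH1.
  case: peval IH2 => // -[p|//] IH2 [<-].
  by apply: ESub; [apply: IH1 | apply: IH2].
- move=> e1 IH1 e2 IH2 v; case: peval IH1 => // v1 IH1.
  case: peval IH2 => // v2 IH2 [<-].
  by apply: EPair; [apply: IH1 | apply: IH2].
- move=> e IH v; case: peval IH => // -[//|v1 v2] IH [<-].
  by apply: EFst; apply: IH.
- move=> e IH v; case: peval IH => // -[//|v1 v2] IH [<-].
  by apply: ESnd; apply: IH.
Qed.

Lemma ev_pair env e1 e2 v1 v2 b1 b2 :
  ev env e1 v1 b1 -> ev env e2 v2 b2 ->
  ev env (Pair e1 e2) (VPair v1 v2) (b1 + b2).+1.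
Proof. by move=> [t Ht H] [t' Ht' H']; exists (t + t').+1; [lia|exact: EPair]. Qed.

Lemma ev_snd env e v1 v2 b : ev env e (VPair v1 v2) b -> ev env (Snd e) v2 b.+1.
Proof. by move=> [t Ht H]; exists t.+1; [lia|exact: ESnd H]. Qed.

Lemma ev_let env e1 e2 v1 v2 b1 b2 :
  ev env e1 v1 b1 -> ev (v1 :: env) e2 v2 b2 ->
  ev env (Let e1 e2) v2 (b1 + b2).+1.
Proof. by move=> [t Ht H] [t' Ht' H']; exists (t + t').+1; [lia|exact: ELet H H']. Qed.

Lemma ev_call env f a body u v b1 b2 :
  ev env a u b1 -> onth A f = Some body -> ev [:: u] body v b2 ->
  ev env (Call f a) v (b1 + b2).+1.
Proof.
by move=> [t Ht H] Hf [t' Ht' H']; exists (t + t').+1; [lia|exact: ECall H Hf H'].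
Qed.

(** The bound charges both branches, which keeps maxima out of the later arithmetic. *)
Lemma ev_if env e e1 e2 w v b b1 b2 :
  ev env e w b -> (w <> VNat 0 -> ev env e1 v b1) ->
  (w = VNat 0 -> ev env e2 v b2) ->
  ev env (If e e1 e2) v (b + b1 + b2).+1.
Proof.
move=> [t Ht H] H1 H2.
have [w0|w0] : w = VNat 0 \/ w <> VNat 0 by case: w {H H1 H2} => [[|m]|v1 v2]; [left|right|right].
  case: (H2 w0) => t2 Ht2 E2; exists (t + t2).+1; first by lia.
  by rewrite w0 in H; exact: EIfZero H E2.
case: (H1 w0) => t1 Ht1 E1; exists (t + t1).+1; first by lia.
exact: EIfNonzero H w0 E1.
Qed.

Lemma ev_if_nat env e e1 e2 m v b b1 b2 :
  ev env e (VNat m) b -> (0 < m -> ev env e1 v b1) ->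
  (m = 0 -> ev env e2 v b2) ->
  ev env (If e e1 e2) v (b + b1 + b2).+1.
Proof.
move=> H H1 H2; apply: ev_if H _ _.
  by move=> H; apply: H1; rewrite lt0n; apply/eqP => m0; apply: H; rewrite m0.
by case.
Qed.

End Evaluation.

(* Subtraction is truncated, so that one of the two terms vanishes. *)
Definition Dist x y := Add (Defs.Sub x y) (Defs.Sub y x).
Definition IfLe x y e1 e2 := If (Defs.Sub x y) e2 e1.
Definition IfEq x y e1 e2 := If (Dist x y) e2 e1.

Lemma ev_if_le A env x y m p e1 e2 v b1 b2 :
  peval env x = Some (VNat m) -> peval env y = Some (VNat p) ->
  (m <= p -> ev A env e1 v b1) -> (~~ (m <= p) -> ev A env e2 v b2) ->
  ev A env (IfLe x y e1 e2) v (esize x + esize y + b1 + b2 + 2).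
Proof.
move=> Hx Hy H1 H2.
apply: ev_le; first apply: ev_if_nat.
- by apply: ev_pure; rewrite /= Hx Hy.
- by move=> H; apply: H2; lia.
- by move=> H; apply: H1; lia.
- by rewrite /=; lia.
Qed.

Lemma ev_if_eq A env x y m p e1 e2 v b1 b2 :
  peval env x = Some (VNat m) -> peval env y = Some (VNat p) ->
  (m = p -> ev A env e1 v b1) -> (m != p -> ev A env e2 v b2) ->
  ev A env (IfEq x y e1 e2) v (2 * esize x + 2 * esize y + b1 + b2 + 4).
Proof.
move=> Hx Hy H1 H2.
apply: ev_le; first apply: ev_if_nat.
- by apply: ev_pure; rewrite /= Hx Hy.
- by move=> H; apply: H2; lia.
- by move=> H; apply: H1; lia.
- by rewrite /=; lia.
Qed.

(* foldbody i s, as the i-th function of a program, maps (ctx, (l, acc)) to the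
   left fold of s over the list l; s sees the accumulator, the current element
   and ctx as variables 0, 1 and 2. *)
Definition foldbody (i : nat) (s : expr) : expr :=
  If (Fst (Snd (Var 0)))
     (Call i (Pair (Fst (Var 0)) (Pair (Snd (Fst (Snd (Var 0))))
        (Let (Fst (Var 0)) (Let (Fst (Fst (Snd (Var 1))))
           (Let (Snd (Snd (Var 2))) s))))))
     (Snd (Snd (Var 0))).

(** The accumulators are indexed by position instead of arising from a step function; [ev_init]
    needs this, where the position names the vertex. The argument of the current call, [arg], stays
    at the bottom of the environment. *)
Lemma ev_fold A i s ctx (xs : seq value) (acc : nat -> value) b m :
  onth A i = Some (foldbody i s) -> size xs <= m ->
  (forall j arg, j < size xs ->
     ev A [:: acc j; nth (VNat 0) xs j; ctx; arg] s (acc j.+1) b) ->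
  ev A [:: VPair ctx (VPair (enc_list xs) (acc 0))] (foldbody i s)
     (acc (size xs)) ((b + 40) * m + 20).
Proof.
move=> Hi; elim: xs acc m => [|x xs IH] acc m Hm Hs.
  apply: ev_le; first apply: (ev_if (b1 := 0)).
  - by apply: ev_pure.
  - by move=> /=; case.
  - by move=> _; apply: ev_pure.
  - by rewrite /=; lia.
case: m Hm => // m Hm.
apply: ev_le; first apply: (ev_if (b2 := 0)).
- by apply: ev_pure.
- move=> _; apply: ev_call Hi _; first apply: ev_pair.
  + exact: ev_pure.
  + apply: ev_pair; first exact: ev_pure.
    apply: ev_let; first exact: ev_pure.
    apply: ev_let; first exact: ev_pure.
    apply: ev_let; first exact: ev_pure.
    exact: (Hs 0).
  + apply: (IH (fun j => acc j.+1) m) => // j arg Hj.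
    exact: (Hs j.+1).
- by [].
- by rewrite /=; lia.
Qed.

Class enc T := encode : T -> value.
Instance enc_nat : enc nat := VNat.
Instance enc_bool : enc bool := fun b => VNat b.
Instance enc_ord n : enc 'I_n := fun i => VNat i.
Instance enc_prod T U (eT : enc T) (eU : enc U) : enc (T * U) :=
  fun x => VPair (encode x.1) (encode x.2).
Instance enc_seq T (eT : enc T) : enc (seq T) := fun s => enc_list (map encode s).

(** The cost of a step can depend on the length of the accumulated list, which is short only while
    the list is sound; such facts pass through [Inv]. *)
Lemma ev_foldl A i s ctx (T : Type) (eT : enc T) (X : eqType) (eX : enc X)
    (f : T -> X -> T) (Inv : T -> Prop) (a0 : T) (l : seq X) b m :
  onth A i = Some (foldbody i s) -> size l <= m -> Inv a0 ->
  (forall a x arg, Inv a -> x \in l ->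
     Inv (f a x) /\ ev A [:: encode a; encode x; ctx; arg] s (encode (f a x)) b) ->
  ev A [:: VPair ctx (VPair (encode l) (encode a0))] (foldbody i s)
     (encode (foldl f a0 l)) ((b + 40) * m + 20).
Proof.
move=> Hi Hm H0 Hs.
pose acc j := @encode T eT (foldl f a0 (take j l)).
have HI j : Inv (foldl f a0 (take j l)).
  clear acc; have: {subset take j l <= l} by move=> x /mem_take.
  elim: (take j l) a0 H0 => //= x l' IH a Ha Hl; apply: IH.
    by apply: (proj1 (Hs a x (VNat 0) Ha _)); rewrite Hl ?mem_head.
  by move=> y Hy; rewrite Hl // inE Hy orbT.
have := @ev_fold A i s ctx (map (@encode X eX) l) acc b m Hi.
rewrite size_map /acc take0 take_size; apply=> // j arg Hj.
case: l Hj HI Hs {Hm acc} => // x0 l Hj HI Hs.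
rewrite (nth_map x0) // (take_nth x0) // foldl_rcons.
by apply: (proj2 (Hs _ _ _ _ _)) => //; apply: mem_nth.
Qed.

(** * The algorithm *)

(* A candidate ((v, (sup, (dem, rho))), (st, (cost, (M, F)))) is a partial
   solution (M, F) on a cluster of vertices that communicates with the rest of
   the tree only through v. Retrieval is seen as a flow in which every vertex
   consumes one unit: dem vertices of the cluster are served through v, and sup
   units arrive at v, where sup = 0 means that v has no source yet. The storage
   cost is st, the retrieval cost is cost, and rho is its rounding. *)
Definition key (V : Type) : Type := V * (nat * (nat * nat)).
Definition cand (V : Type) : Type :=
  key V * (nat * (nat * (seq V * seq (V * V)))).

Section Candidate.
Variables (V : Type) (c : cand V).
Definition cv := c.1.1.
Definition csup := c.1.2.1.
Definition cdem := c.1.2.2.1.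
Definition crho := c.1.2.2.2.
Definition cst := c.2.1.
Definition ccost := c.2.2.1.
Definition cM := c.2.2.2.1.
Definition cF := c.2.2.2.2.
End Candidate.

Section Algorithm.
Variables (V : finType) (G : version_graph V) (B Q : nat).
Notation cand := (cand V).

(* quot x is Q * x / B up to one unit; the increments x
   are accumulated Q times modulo B because division is not available. *)
Definition quot_step (x : nat) (a : nat * nat) (_ : nat) :=
  if a.1 + x <= B then (a.1 + x, a.2) else (a.1 + x - B, a.2.+1).
Definition quot (x : nat) : nat := (foldl (quot_step x) (0, 0) (iota 0 Q)).2.

(** Beyond [B] the counter [quot] falls behind, and for the right guess no term of the optimal
    solution exceeds [B]. The lists are joined by [catrev] because it is a single left fold and
    their order is immaterial. *)
Definition comb (cu cw : cand) (sup dem j s r : nat) (Fe : seq (V * V)) :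
    seq cand :=
  if j * r <= B then
    [:: ((cv cu, (sup, (dem, crho cu + crho cw + quot (j * r)))),
         (cst cu + cst cw + s, (ccost cu + ccost cw + j * r,
           (catrev (cM cw) (cM cu), catrev Fe (catrev (cF cw) (cF cu))))))]
  else [::].

(* Merges the cluster of the leaf w into that of its neighbour u. Either w has no
   source and is served through u, or the supply of w is exactly consumed and the
   edge is not used, or the surplus of w serves u. *)
Definition attach (u w : V) (cu cw : cand) : seq cand :=
  if csup cw == 0 then
    comb cu cw (csup cu) (cdem cu + cdem cw) (cdem cw)
      (edge_store G u w) (edge_ret G u w) [:: (u, w)]
  else if csup cw == cdem cw then comb cu cw (csup cu) (cdem cu) 0 0 0 [::]
  else if cdem cw <= csup cw then
    if csup cu == 0 then
      comb cu cw (csup cw - cdem cw) (cdem cu) (csup cw - cdem cw)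
        (edge_store G w u) (edge_ret G w u) [:: (w, u)]
    else [::]
  else [::].

(** The first component is the best candidate so far with the key of the inserted one. Keeping one
    candidate per key bounds the length of a list by the number of keys. *)
Definition ins_step (a : cand * seq cand) (x : cand) :=
  if x.1 == a.1.1 then (if cst x <= cst a.1 then (x, a.2) else a)
  else (a.1, x :: a.2).
Definition ins (L : seq cand) (c : cand) : seq cand :=
  let a := foldl ins_step (c, [::]) L in a.1 :: a.2.

Definition step2 (uw : V * V) (c1 : cand) (acc : seq cand) (c2 : cand) :=
  if cv c2 == uw.1 then foldl ins acc (attach uw.1 uw.2 c2 c1) else acc.

Definition step1 (uw : V * V) (L : seq cand) (acc : seq cand) (c1 : cand) :=
  if cv c1 == uw.2 then foldl (step2 uw c1) acc L
  else if cv c1 == uw.1 then acc else ins acc c1.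

Definition step (L : seq cand) (uw : V * V) : seq cand :=
  foldl (step1 uw L) [::] L.

End Algorithm.

Section Search.
Variables (V : finType) (G : version_graph V) (root : V).

Definition init_step (v : V) (L : seq (cand V)) (a : nat) : seq (cand V) :=
  ins L ((v, (a.+1, (1, 0))), (vertex_store G v, (0, ([:: v], [::])))).

Definition init_vertex (m : nat) (L : seq (cand V)) (v : V) :=
  foldl (init_step v)
    (ins L ((v, (0, (1, 0))), (0, (0, ([::], [::]))))) (iota 0 m).

Definition init (m : nat) (vs : seq V) : seq (cand V) :=
  foldl (init_vertex m) [::] vs.

Definition dp B Q (m : nat) (vs : seq V) (o : seq (V * V)) : seq (cand V) :=
  foldl (step G B Q) (init m vs) o.

Definition visited (o : seq (V * V)) : seq V := root :: [seq e.2 | e <- o].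

(** New edges go in front, so the head leads to the vertex reached last, a leaf of the visited part:
    read from its head, the list is an elimination order. *)
Definition visit (o : seq (V * V)) (e : V * V) :=
  if e.1 \in visited o then if e.2 \in visited o then o else e :: o else o.

Definition search (m : nat) (es : seq (V * V)) : seq (V * V) :=
  foldl (fun o _ => foldl visit o es) [::] (iota 0 m).

Definition guess_step (e : V * V) (acc : seq nat) (j : nat) :=
  j.+1 * edge_ret G e.1 e.2 :: acc.
Definition guesses (m : nat) (es : seq (V * V)) : seq nat :=
  foldl (fun acc e => foldl (guess_step e) acc (iota 0 m)) [:: 0] es.

(* The best candidate so far, if any, as a list of length at most one. *)
Definition select_step (S : nat) (best : seq (cand V)) (c : cand V) :=
  if cv c == root then
    if csup c == cdem c then
      if cst c <= S then
        if best is b :: _ then if ccost b <= ccost c then best else [:: c]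
        else [:: c]
      else best
    else best
  else best.

Definition solve (Q m S : nat) (vs : seq V) (es : seq (V * V)) : seq (cand V) :=
  let o := search m es in
  foldl (fun best B => foldl (select_step S) best (dp B Q m vs o))
    [::] (guesses m es).

End Search.

(** * Elimination orders of a tree *)

Section Tree.
Variables (V : finType) (e : rel V) (root : V).
Hypothesis e_tree : undirected_tree e.

(* In the order of elimination, w is a leaf of the tree induced on the vertices
   that remain, with neighbour u. *)
Fixpoint elim_order (o : seq (V * V)) : Prop :=
  if o is (u, w) :: o' then
    [/\ w \notin visited root o', u \in visited root o', e u w,
        {in visited root o', forall x, e x w -> x = u} & elim_order o']
  else True.

Lemma visited_cons x uw o :
  (x \in visited root (uw :: o)) = (x == uw.2) || (x \in visited root o).
Proof. by rewrite !inE orbCA. Qed.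

Definition visited_edge (o : seq (V * V)) : rel V :=
  [rel a b | [&& e a b, a \in visited root o & b \in visited root o]].

Lemma visited_edge_sym o : symmetric (visited_edge o).
Proof. by case: e_tree => _ e_sym _ _ _ a b; rewrite /visited_edge /= e_sym; congr andb; apply: andbC. Qed.

Lemma elim_order_connect o : elim_order o ->
  {in visited root o, forall x, connect (visited_edge o) root x}.
Proof.
elim: o => [_ x|[u w] o IH /= [w_new u_old euw _ Ho] x].
  by rewrite inE => /eqP->; apply: connect0.
have sub : subrel (connect (visited_edge o)) (connect (visited_edge ((u, w) :: o))).
  apply: connect_sub => a b /= /and3P[eab a_o b_o]; apply: connect1.
  by rewrite /visited_edge /= eab !visited_cons a_o b_o !orbT.
rewrite visited_cons => /orP[/eqP->|x_o]; last exact: sub (IH Ho x x_o).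
apply: connect_trans (sub _ _ (IH Ho u u_old)) (connect1 _).
by rewrite /visited_edge /= euw !visited_cons eqxx u_old orbT.
Qed.

(** The visited vertices are connected among themselves, so a second visited neighbour of the new
    vertex [w], besides [u], would close a cycle through [w]. *)
Lemma visit_elim_order o uw : e uw.1 uw.2 -> elim_order o ->
  elim_order (visit root o uw).
Proof.
case: e_tree => _ e_sym e_irr _ e_acyc; case: uw => u w /= euw Ho; rewrite /visit /=.
case: ifP => // u_o; case: ifPn => // w_o; split=> // x x_o exw.
apply: contraTeq isT => xu; apply/negP => _.
have /connectP[p Hp lastp] : connect (visited_edge o) x u.
  apply: connect_trans (elim_order_connect Ho u_o).
  by rewrite (sym_connect_sym (@visited_edge_sym o)) elim_order_connect.
case/shortenP: Hp lastp => p' Hp' Up' _ lastp.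
have sub' : {subset x :: p' <= visited root o}.
  elim: p' x x_o Hp' {Up' lastp exw xu} => [a a_o _ b|b q IH a a_o /= /andP[/and3P[_ _ b_o] Hq] y].
    by rewrite mem_seq1 => /eqP->.
  by rewrite inE => /orP[/eqP->//|]; apply: IH.
(* The cycle has more than two vertices because [x != u] makes [p'] nonempty. *)
apply: (e_acyc (w :: x :: p')).
  by case: p' lastp {Hp' Up' sub'} => // ux; rewrite ux eqxx in xu.
apply/andP; split.
  rewrite /= e_sym exw rcons_path -lastp euw andbT.
  by apply: sub_path Hp' => a b /andP[].
by rewrite cons_uniq Up' andbT; apply: contra w_o => /sub'.
Qed.

Lemma visit_foldl_elim_order o es : {in es, forall uw, e uw.1 uw.2} ->
  elim_order o -> elim_order (foldl (visit root) o es).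
Proof.
elim: es o => //= uw es IH o Hes Ho; apply: IH.
  by move=> x x_es; apply: Hes; rewrite inE x_es orbT.
by apply: visit_elim_order => //; apply: Hes; apply: mem_head.
Qed.

Lemma search_elim_order m es : {in es, forall uw, e uw.1 uw.2} ->
  elim_order (search root m es).
Proof.
rewrite /search => Hes; elim: (iota 0 m) [::] (I : elim_order [::]) => //= _ l IH o Ho.
by apply: IH; apply: visit_foldl_elim_order.
Qed.

Lemma visited_uniq o : elim_order o -> uniq (visited root o).
Proof.
elim: o => //= -[u w] o IH [w_o _ _ _ /IH]; move: w_o.
by rewrite /visited /= !inE !negb_or eq_sym => /andP[-> ->] /andP[-> ->].
Qed.

Lemma size_elim_order o : elim_order o -> size o < #|V|.
Proof.
by move=> /visited_uniq /card_uniqP; rewrite /visited /= size_map => <-; apply: max_card.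
Qed.

Lemma visit_foldl_mono o es :
  {subset visited root o <= visited root (foldl (visit root) o es)}.
Proof.
elim: es o => [|uw es IH] o x //= x_o; apply: IH; rewrite /visit.
by case: ifP => // _; case: ifP => // _; rewrite visited_cons x_o orbT.
Qed.

Lemma visit_foldl_edge o es u w : (u, w) \in es -> u \in visited root o ->
  w \in visited root (foldl (visit root) o es).
Proof.
elim: es o => //= uw es IH o; rewrite inE => /orP[/eqP<- u_o|uw_es u_o].
  apply: visit_foldl_mono; rewrite /visit /= u_o.
  by case: ifP => // _; rewrite visited_cons eqxx.
apply: IH => //; rewrite /visit.
by case: ifP => // _; case: ifP => // _; rewrite visited_cons u_o orbT.
Qed.

(** Each round scans all edges and so advances by at least one vertex along a fixed path from
    [root]; a path without repetition has fewer than [#|V|] edges. *)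
Lemma search_complete m es x : (forall u w, e u w -> (u, w) \in es) ->
  #|V| <= m -> x \in visited root (search root m es).
Proof.
move=> Hes Hm; case: e_tree => _ _ _ /(_ root x) /connectP[p Hp ->] _.
case/shortenP: Hp => q Hq Uq _.
have Hqm : size q <= m.
  by apply: leq_trans Hm; move/card_uniqP: Uq => /= Uq; apply: ltnW; rewrite -Uq max_card.
rewrite /search.
have gen (l : seq nat) q' r o : path e r q' -> size q' <= size l -> r \in visited root o ->
    last r q' \in visited root (foldl (fun o _ => foldl (visit root) o es) o l).
  elim: l q' r o => [[|//] //|i l IH [|y q'] r o Hq' Hs r_o] /=.
    by apply: (IH [::]) => //; apply: visit_foldl_mono.
  case/andP: Hq' => ery Hq'; apply: IH => //.
  by apply: visit_foldl_edge r_o; apply: Hes.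
by apply: gen => //; [rewrite size_iota | apply: mem_head].
Qed.

End Tree.

(** * Pruned lists of candidates *)

Section Insertion.
Variable V : finType.
Implicit Types (c x : cand V) (L : seq (cand V)).

Lemma foldl_ins_step L a :
  let r := foldl (@ins_step V) a L in
  [/\ r.1.1 = a.1.1, {subset r.1 :: r.2 <= a.1 :: a.2 ++ L},
      a.1.1 \notin [seq y.1 | y <- a.2] -> uniq [seq y.1 | y <- a.2 ++ L] ->
      uniq [seq y.1 | y <- r.1 :: r.2] &
      forall y, y \in a.1 :: a.2 ++ L ->
        exists2 z, z \in r.1 :: r.2 & z.1 = y.1 /\ cst z <= cst y].
Proof.
elim: L a => [|x L IH] [b l] /=.
  split=> //; first by rewrite cats0.
    by rewrite cats0 => -> ->.
  by rewrite cats0 => y Hy; exists y.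
rewrite /ins_step /=; case: eqP => [xb|/eqP xb].
  set a' := if _ then _ else _.
  have [E1 E2] : a'.1.1 = b.1 /\ a'.2 = l by rewrite /a'; case: ifP.
  have a'b : a'.1 \in [:: b; x] by rewrite /a'; case: ifP => _ /=; rewrite !inE eqxx ?orbT.
  have [a'_b a'_x] : cst a'.1 <= cst b /\ cst a'.1 <= cst x.
    by rewrite /a'; case: ifP => /= H; split=> //; lia.
  case: (IH a'); rewrite E1 E2 => R1 R2 R3 R4; split=> //.
  - move=> y /R2; rewrite !inE !mem_cat !inE => /orP[/eqP->|/orP[->|->]].
    + by move: a'b; rewrite !inE => /orP[] ->; rewrite ?orbT.
    + by rewrite orbT.
    + by rewrite !orbT.
  - move=> H1 H2; apply: R3 => //.
    apply: subseq_uniq H2; apply: map_subseq.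
    by apply: cat_subseq => //; apply: subseq_cons.
  - have Ra : exists2 z, z \in (foldl (@ins_step V) a' L).1 :: (foldl (@ins_step V) a' L).2 &
        z.1 = b.1 /\ cst z <= cst a'.1.
      by case: (R4 a'.1 (mem_head _ _)) => z Hz [Hz1 Hz2]; exists z; rewrite ?Hz1.
    move=> y; rewrite !inE mem_cat inE.
    case/orP => [/eqP->|/orP[yl|/orP[/eqP->|yL]]].
    + by case: Ra => z Hz [Hz1 Hz2]; exists z => //; rewrite Hz1; split=> //; apply: leq_trans a'_b.
    + by apply: R4; rewrite inE mem_cat yl orbT.
    + by case: Ra => z Hz [Hz1 Hz2]; exists z => //; rewrite Hz1; split=> //; apply: leq_trans a'_x.
    + by apply: R4; rewrite inE mem_cat yL !orbT.
case: (IH (b, x :: l)) => /= R1 R2 R3 R4.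
have perm y : (y \in b :: (x :: l) ++ L) = (y \in b :: l ++ x :: L).
  by rewrite /= !inE !mem_cat !inE; do !case: (y \in _) (y == _) => -[] //.
split=> //.
- by move=> y /R2; rewrite perm.
- move=> H1 H2; apply: R3; first by rewrite inE negb_or eq_sym xb.
  by move: H2; rewrite !map_cat map_cons -cat1s uniq_catCA.
- by move=> y; rewrite -perm => /R4.
Qed.

Lemma mem_ins L c x : x \in ins L c -> x = c \/ x \in L.
Proof.
by case: (foldl_ins_step L (c, [::])) => _ H _ _ /H /=; rewrite inE => /orP[/eqP|]; auto.
Qed.

Lemma ins_uniq L c : uniq [seq y.1 | y <- L] -> uniq [seq y.1 | y <- ins L c].
Proof. by case: (foldl_ins_step L (c, [::])) => _ _ H _; apply: H. Qed.

(** Pruning may replace a candidate by another one with its key, so this is the form in which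
    membership survives insertions. *)
Definition dominates L y := exists2 z, z \in L & z.1 = y.1 /\ cst z <= cst y.

Lemma ins_dominates L c y : (y = c \/ dominates L y) -> dominates (ins L c) y.
Proof.
case: (foldl_ins_step L (c, [::])) => _ _ _ H.
have {}H y' : y' \in c :: L -> dominates (ins L c) y' by apply: H.
case=> [->|[z zL [zy zst]]]; first by apply: H; apply: mem_head.
have [|z' z'L [z'z z'st]] := H z; first by rewrite inE zL orbT.
by exists z' => //; split; [rewrite z'z | apply: leq_trans zst].
Qed.

Lemma foldl_ins_ind (P : cand V -> Prop) L s :
  (uniq [seq y.1 | y <- L] /\ forall c, c \in L -> P c) ->
  (forall c, c \in s -> P c) ->
  uniq [seq y.1 | y <- foldl (@ins V) L s] /\
  forall c, c \in foldl (@ins V) L s -> P c.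
Proof.
elim: s L => [|c s IH] L [UL PL] Ps //=; apply: IH.
  split; first exact: ins_uniq.
  by move=> x /mem_ins [->|/PL//]; apply: Ps; apply: mem_head.
by move=> x xs; apply: Ps; rewrite inE xs orbT.
Qed.

Lemma foldl_ins_dominates L s y :
  (y \in s \/ dominates L y) -> dominates (foldl (@ins V) L s) y.
Proof.
elim: s L => [|c s IH] L /=; first by case.
case=> [|H]; first rewrite inE => /orP[/eqP yc|ys].
- by apply: IH; right; apply: ins_dominates; left.
- by apply: IH; left.
- by apply: IH; right; apply: ins_dominates; right.
Qed.

End Insertion.

Lemma foldl_flatten (T X Y : Type) (g : T -> Y -> T) (h : X -> seq Y) a l :
  foldl (fun acc x => foldl g acc (h x)) a l = foldl g a (flatten (map h l)).
Proof. by elim: l a => //= x l IH a; rewrite IH foldl_cat. Qed.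

Section Step.
Variables (V : finType) (G : version_graph V) (B Q : nat).
Implicit Types (c : cand V) (L : seq (cand V)).

Definition offers2 (uw : V * V) c1 c2 :=
  if cv c2 == uw.1 then attach G B Q uw.1 uw.2 c2 c1 else [::].

Definition offers1 (uw : V * V) L c1 :=
  if cv c1 == uw.2 then flatten (map (offers2 uw c1) L)
  else if cv c1 == uw.1 then [::] else [:: c1].

Lemma step2E uw c1 acc c2 :
  step2 G B Q uw c1 acc c2 = foldl (@ins V) acc (offers2 uw c1 c2).
Proof. by rewrite /step2 /offers2; case: ifP. Qed.

Lemma step1E uw L acc c1 :
  step1 G B Q uw L acc c1 = foldl (@ins V) acc (offers1 uw L c1).
Proof.
rewrite /step1 /offers1; case: ifP => _.
  by rewrite -foldl_flatten; elim: L acc => //= x L IH acc; rewrite step2E IH.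
by case: ifP.
Qed.

(** As a single fold of [ins], the nested folds reduce the question of what is dominated to list
    membership. *)
Lemma stepE L uw :
  step G B Q L uw = foldl (@ins V) [::] (flatten (map (offers1 uw L) L)).
Proof.
rewrite /step -foldl_flatten.
have H l acc : foldl (step1 G B Q uw L) acc l =
    foldl (fun acc x => foldl (@ins V) acc (offers1 uw L x)) acc l.
  by elim: l acc => //= x l IH acc; rewrite step1E IH.
exact: H.
Qed.

Lemma step_attach L u w c1 c2 c : c1 \in L -> c2 \in L -> cv c1 = w -> cv c2 = u ->
  c \in attach G B Q u w c2 c1 -> dominates (step G B Q L (u, w)) c.
Proof.
move=> L1 L2 c1w c2u Hc; rewrite stepE; apply: foldl_ins_dominates; left.
apply/flatten_mapP; exists c1 => //; rewrite /offers1 /= c1w eqxx.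
by apply/flatten_mapP; exists c2 => //; rewrite /offers2 /= c2u eqxx.
Qed.

Lemma step_keep L u w c : c \in L -> cv c != u -> cv c != w ->
  dominates (step G B Q L (u, w)) c.
Proof.
move=> cL /negPf cu /negPf cw; rewrite stepE; apply: foldl_ins_dominates; left.
by apply/flatten_mapP; exists c => //; rewrite /offers1 /= cu cw mem_head.
Qed.

(** After [i] rounds, [i * x] is the remainder plus [B] times the counter. The remainder may equal
    [B], so the guess [B = 0] needs no special treatment. *)
Lemma quot_spec x : x <= B ->
  exists2 r, r <= B & Q * x = r + B * quot B Q x.
Proof.
move=> xB; rewrite /quot.
suff: (foldl (quot_step B x) (0, 0) (iota 0 Q)).1 <= B /\
    Q * x = (foldl (quot_step B x) (0, 0) (iota 0 Q)).1 +
      B * (foldl (quot_step B x) (0, 0) (iota 0 Q)).2.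
  by case=> H1 H2; exists (foldl (quot_step B x) (0, 0) (iota 0 Q)).1.
elim: Q => [|m [IH1 IH2]]; first by rewrite /= muln0.
rewrite -addn1 iotaD foldl_cat /= {1 3 5}/quot_step.
by case: ifP => H /=; split; try lia; rewrite mulnDl IH2; nia.
Qed.

Lemma quot_le x : quot B Q x <= Q.
Proof.
rewrite /quot; elim: Q => // m IH.
rewrite -addn1 iotaD foldl_cat /= {1}/quot_step.
by case: ifP => H /=; lia.
Qed.

Lemma quot0 : quot B Q 0 = 0.
Proof.
rewrite /quot; have -> : foldl (quot_step B 0) (0, 0) (iota 0 Q) = (0, 0) => //.
by elim: (iota 0 Q).
Qed.

End Step.

(** * Soundness of the dynamic program *)

Section Soundness.
Variables (V : finType) (G : version_graph V).
Implicit Types (M : seq V) (F : seq (V * V)) (C : {set V}) (c : cand V).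

Definition route F (v x : V) (d : nat) : Prop :=
  exists p, [/\ path (fun a b => (a, b) \in F) v p, last v p = x &
                path_cost G v p = d].

Definition retrievable M F (x : V) (d : nat) : Prop :=
  exists2 y, y \in M & route F y x d.

Lemma route_refl F v : route F v v 0.
Proof. by exists [::]. Qed.

Lemma route_edge F u w : (u, w) \in F -> route F u w (edge_ret G u w).
Proof. by exists [:: w]; rewrite /= andbT /path_cost /= addn0. Qed.

Lemma route_trans F v y x d d' :
  route F v y d -> route F y x d' -> route F v x (d + d').
Proof.
move=> [p [Hp lp <-]] [q [Hq lq <-]]; exists (p ++ q).
by rewrite cat_path last_cat lp Hp Hq /path_cost pairmap_cat sumn_cat lp.
Qed.

Lemma route_mono F F' v x d : {subset F <= F'} -> route F v x d -> route F' v x d.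
Proof.
move=> sub [p [Hp lp cp]]; exists p; split=> //.
by apply: sub_path Hp => a b; apply: sub.
Qed.

Lemma retrievable_mono M M' F F' x d : {subset M <= M'} -> {subset F <= F'} ->
  retrievable M F x d -> retrievable M' F' x d.
Proof. by move=> sM sF [y /sM yM /(route_mono sF) H]; exists y. Qed.

Lemma retrievable_route M F y x d d' :
  retrievable M F y d -> route F y x d' -> retrievable M F x (d + d').
Proof. by move=> [z zM Hz] H; exists z => //; apply: route_trans Hz H. Qed.

(* Dep is the set of vertices served through the interface v of c: for those D
   is the distance from v, for the others the distance from a materialized
   vertex; h is the retrieval cost of v itself. The sup units that arrive at v
   have been charged h each, whether or not they have been consumed already. *)
Definition served C c : Prop :=
  exists (Dep : {set V}) (D : V -> nat) (h : nat),
    [/\ cv c \in Dep, Dep \subset C, #|Dep| = cdem c &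
    [/\ forall x, x \in Dep -> route (cF c) (cv c) x (D x),
        forall x, x \in C -> x \notin Dep -> retrievable (cM c) (cF c) x (D x),
        0 < csup c -> retrievable (cM c) (cF c) (cv c) h &
        \sum_(x in C) D x + csup c * h <= ccost c]].

Variables (B Q m : nat).

(** The last bound is the accumulated rounding error, one [B] for each of the [#|C| - 1] attachments
    that built [C]; the others limit the number of keys and the lengths of the lists. *)
Definition bounded C c : Prop :=
  [/\ size (cM c) <= #|C|, size (cF c) < #|C|, csup c <= m,
      crho c + Q <= Q * #|C| & Q * ccost c + B <= B * (crho c + #|C|)].

Definition stored c : Prop :=
  {subset cF c <= [pred e | edge G e.1 e.2]} /\
  \sum_(v <- cM c) vertex_store G v + \sum_(e <- cF c) edge_store G e.1 e.2
    <= cst c.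

Definition sound C c : Prop := [/\ served C c, bounded C c & stored c].

Lemma sum_catrev (I : Type) (f : I -> nat) s t :
  \sum_(i <- catrev s t) f i = \sum_(i <- s) f i + \sum_(i <- t) f i.
Proof.
elim: s t => [|x s IH] t /=; first by rewrite big_nil.
by rewrite IH !big_cons addnCA addnA.
Qed.

Lemma mem_catrev (T : eqType) (s t : seq T) x :
  (x \in catrev s t) = (x \in s) || (x \in t).
Proof. by rewrite catrevE mem_cat mem_rev. Qed.

Lemma size_catrev (T : Type) (s t : seq T) : size (catrev s t) = size s + size t.
Proof. by rewrite catrevE size_cat size_rev. Qed.

Lemma combP cu cw sup dem j s r (Fe : seq (V * V)) c : c \in comb B Q cu cw sup dem j s r Fe ->
  [/\ j * r <= B, c.1 = (cv cu, (sup, (dem, crho cu + crho cw + quot B Q (j * r)))),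
      cst c = cst cu + cst cw + s, ccost c = ccost cu + ccost cw + j * r &
      cM c = catrev (cM cw) (cM cu) /\ cF c = catrev Fe (catrev (cF cw) (cF cu))].
Proof. by rewrite /comb; case: ifP => // H; rewrite inE => /eqP->. Qed.

Lemma comb_sound (Cu Cw : {set V}) cu cw sup dem j s r (Fe : seq (V * V)) c :
  [disjoint Cu & Cw] -> sound Cu cu -> sound Cw cw -> sup <= m -> size Fe <= 1 ->
  {subset Fe <= [pred e | edge G e.1 e.2]} ->
  \sum_(e <- Fe) edge_store G e.1 e.2 <= s ->
  c \in comb B Q cu cw sup dem j s r Fe ->
  bounded (Cu :|: Cw) c /\ stored c.
Proof.
move=> dis [_ [bu1 bu2 bu3 bu4 bu5] [fu su]] [_ [bw1 bw2 bw3 bw4 bw5] [fw sw]].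
move=> supm sFe eFe stFe /combP[jrB c1 cs cc [cm cf]].
have [E1 E2] : csup c = sup /\ crho c = crho cu + crho cw + quot B Q (j * r).
  by rewrite /csup /crho c1.
have card : #|Cu :|: Cw| = #|Cu| + #|Cw|.
  by apply/eqP; rewrite (leq_card_setU Cu Cw).
have [rem rB Hq] := quot_spec Q jrB.
have := quot_le B Q (j * r).
move: Hq; set q := quot B Q _ => Hq Hq'.
split; last split.
- rewrite /bounded card E1 E2 cm cf cc !size_catrev; split=> //; lia.
- move=> x; rewrite cf !mem_catrev => /or3P[]; [exact: eFe|exact: fw|exact: fu].
- by rewrite cm cf cs !sum_catrev; lia.
Qed.

(** The vertices in [Dep], so far measured from the interface of [Cw], get a new origin at distance
    [d] from it: the neighbouring interface or a materialized vertex. *)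
Lemma sum_union_shift (Cu Cw Dep : {set V}) (Du Dw : V -> nat) d :
  [disjoint Cu & Cw] -> Dep \subset Cw ->
  \sum_(x in Cu :|: Cw) (if x \in Cw then Dw x + (x \in Dep) * d else Du x) =
  \sum_(x in Cu) Du x + (\sum_(x in Cw) Dw x + #|Dep| * d).
Proof.
move=> dis sub; rewrite (big_setID Cw) /= addnC.
have -> : (Cu :|: Cw) :\: Cw = Cu.
  by rewrite setDUl setDv setU0; apply/setDidPl.
have -> : (Cu :|: Cw) :&: Cw = Cw by rewrite setIUl setIid; apply/setUidPr/subsetIr.
congr (_ + _).
  apply: eq_bigr => x xu; case: ifP => // xw.
  by move/pred0P: dis => /(_ x) /=; rewrite xu xw.
rewrite (eq_bigr (fun x => Dw x + (x \in Dep) * d)); last by move=> x ->.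
rewrite big_split /= -big_distrl /= -sum1_card; congr (_ + _ * _).
rewrite (big_setID Dep) /= (setIidPr sub) [X in _ + X]big1 ?addn0.
  by apply: eq_bigr => x ->.
by move=> x; rewrite inE => /andP[/negPf->].
Qed.

Lemma attach_sound (Cu Cw : {set V}) u w cu cw c :
  [disjoint Cu & Cw] -> edge G u w -> edge G w u ->
  sound Cu cu -> sound Cw cw -> cv cu = u -> cv cw = w ->
  c \in attach G B Q u w cu cw -> cv c = u /\ sound (Cu :|: Cw) c.
Proof.
move=> dis euw ewu Su Sw vu vw Hc.
have {Hc} [sup [dem [j [s [r [Fe Hc]]]]]] : exists sup dem j s r (Fe : seq (V * V)),
  c \in comb B Q cu cw sup dem j s r Fe /\
  ([/\ csup cw = 0, sup = csup cu, dem = cdem cu + cdem cw &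
     [/\ j = cdem cw, s = edge_store G u w, r = edge_ret G u w & Fe = [:: (u, w)]]]
  \/ [/\ 0 < csup cw, csup cw = cdem cw, sup = csup cu, dem = cdem cu &
      [/\ j = 0, s = 0, r = 0 & Fe = [::]]]
  \/ [/\ cdem cw < csup cw, csup cu = 0, sup = csup cw - cdem cw, dem = cdem cu &
      [/\ j = csup cw - cdem cw, s = edge_store G w u, r = edge_ret G w u &
          Fe = [:: (w, u)]]]).
  move: Hc; rewrite /attach; case: eqP => [w0|/eqP w0].
    by move=> H; do 6!eexists; split; [exact: H | left].
  case: eqP => [wd|/eqP wd].
    by move=> H; do 6!eexists; split; [exact: H | right; left; split; rewrite ?lt0n].
  case: ifP => // wle; case: eqP => // u0 H.
  do 6!eexists; split; first exact: H.
  by right; right; split=> //; rewrite ltn_neqAle eq_sym wd.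
case: Hc => Hc cases.
have vc : cv c = u by case/combP: (Hc) => _ c1 _ _ _; rewrite /cv c1.
split=> //.
suff [sv [sm [sF [eF stF]]]] : served (Cu :|: Cw) c /\ sup <= m /\ size Fe <= 1 /\
    {subset Fe <= [pred e | edge G e.1 e.2]} /\
    \sum_(e <- Fe) edge_store G e.1 e.2 <= s.
  by have [] := comb_sound dis Su Sw sm sF eF stF Hc.
have [_ [_ _ bu _ _] _] := Su; have [_ [_ _ bw _ _] _] := Sw.
split; last first.
  case: cases => [[_ -> _ [_ -> _ ->]]|[[_ _ -> _ [_ -> _ ->]]|[_ _ -> _ [_ -> _ ->]]]];
    (split; [lia|split; [by []|split]]); rewrite ?big_nil ?big_cons ?big_nil ?addn0 //;
    by move=> x; rewrite inE => /eqP->.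
case: Su => -[Du [D_u [h_u [u1 u2 u3 [u4 u5 u6 u7]]]]] _ _.
case: Sw => -[Dw [D_w [h_w [w1 w2 w3 [w4 w5 w6 w7]]]]] _ _.
have [_ c1 _ cc [cm cf]] := combP Hc.
have {c1} [csupE cdemE] : csup c = sup /\ cdem c = dem by rewrite /csup /cdem c1.
have subMu : {subset cM cu <= cM c} by move=> x; rewrite cm mem_catrev => ->; rewrite orbT.
have subMw : {subset cM cw <= cM c} by move=> x; rewrite cm mem_catrev => ->.
have subFu : {subset cF cu <= cF c} by move=> x; rewrite cf !mem_catrev => ->; rewrite !orbT.
have subFw : {subset cF cw <= cF c} by move=> x; rewrite cf !mem_catrev => ->; rewrite orbT.
have subFe : {subset Fe <= cF c} by move=> x; rewrite cf !mem_catrev => ->.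
have uNw x : x \in Cu -> (x \in Cw) = false.
  by move=> xu; move/pred0P: dis => /(_ x) /=; rewrite xu.
have DuNw x : x \in Du -> (x \in Cw) = false by move=> /(subsetP u2); apply: uNw.
case: cases => [|[]].
(* [w] is served through [u]: its dependents become dependents of [u], farther by [r], which the new
   term [cdem cw * r] pays. *)
- case=> w0 sE dE [jE _ rE FE].
  exists (Du :|: Dw), (fun x => if x \in Cw then D_w x + (x \in Dw) * r else D_u x), h_u.
  split; first by rewrite vc -vu inE u1.
  + by apply: setUSS.
  + rewrite cdemE dE -u3 -w3; apply/eqP; rewrite (leq_card_setU Du Dw).
    by apply: disjointWl u2 _; apply: disjointWr w2 _.
  split.
  + move=> x; rewrite inE => /orP[xu|xw].
      by rewrite DuNw // vc -vu; apply: route_mono (u4 x xu).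
    rewrite (subsetP w2) // xw mul1n vc addnC; apply: route_trans (route_mono subFw (w4 x xw)).
    by rewrite vw rE; apply: route_edge; apply: subFe; rewrite FE mem_head.
  + move=> x; rewrite !inE negb_or => xC /andP[xu xw].
    case: ifP xC => [xCw _|_]; last first.
      by rewrite orbF => xCu; apply: retrievable_mono (u5 x xCu xu).
    by rewrite (negPf xw) mul0n addn0; apply: retrievable_mono (w5 x xCw xw).
  + by rewrite csupE sE vc -vu => /u6; apply: retrievable_mono.
  + by rewrite sum_union_shift // csupE cc sE w3 jE; lia.
(* The supply of [w] is used up: its dependents are settled at an additional distance [h_w], and the
   advance charge [csup cw * h_w] pays for exactly these. *)
- case=> w0 wd sE dE [jE _ rE FE].
  exists Du, (fun x => if x \in Cw then D_w x + (x \in Dw) * h_w else D_u x), h_u.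
  split; first by rewrite vc -vu.
  + by apply: subset_trans u2 (subsetUl _ _).
  + by rewrite cdemE dE.
  split.
  + by move=> x xu; rewrite DuNw // vc -vu; apply: route_mono (u4 x xu).
  + move=> x; rewrite inE => xC xu; case: ifP xC => [xCw _|_]; last first.
      by rewrite orbF => xCu; apply: retrievable_mono (u5 x xCu xu).
    apply: (@retrievable_mono (cM cw) _ (cF cw)) => //.
    case: (boolP (x \in Dw)) => xw; last by rewrite mul0n addn0; apply: w5.
    by rewrite mul1n addnC; apply: retrievable_route (w6 w0) (w4 x xw).
  + by rewrite csupE sE vc -vu => /u6; apply: retrievable_mono.
  + by rewrite sum_union_shift // csupE cc sE w3 -wd jE; lia.
(* A surplus goes to [u]: one part of the charge [csup cw * h_w] settles the dependents of [w], and
   the rest, together with [j * r], is the charge for the supply of [u] at distance [h_w + r]. *)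
- case=> wd u0 sE dE [jE _ rE FE].
  have {}w6 : retrievable (cM cw) (cF cw) (cv cw) h_w by apply: w6; lia.
  exists Du, (fun x => if x \in Cw then D_w x + (x \in Dw) * h_w else D_u x), (h_w + r).
  split; first by rewrite vc -vu.
  + by apply: subset_trans u2 (subsetUl _ _).
  + by rewrite cdemE dE.
  split.
  + by move=> x xu; rewrite DuNw // vc -vu; apply: route_mono (u4 x xu).
  + move=> x; rewrite inE => xC xu; case: ifP xC => [xCw _|_]; last first.
      by rewrite orbF => xCu; apply: retrievable_mono (u5 x xCu xu).
    apply: (@retrievable_mono (cM cw) _ (cF cw)) => //.
    case: (boolP (x \in Dw)) => xw; last by rewrite mul0n addn0; apply: w5.
    by rewrite mul1n addnC; apply: retrievable_route w6 (w4 x xw).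
  + move=> _; rewrite vc; apply: retrievable_route (retrievable_mono subMw subFw w6) _.
    by rewrite vw rE; apply: route_edge; apply: subFe; rewrite FE mem_head.
  + rewrite sum_union_shift // csupE cc sE w3 jE mulnDr.
    have : csup cw * h_w = cdem cw * h_w + (csup cw - cdem cw) * h_w.
      by rewrite -mulnDl subnKC // ltnW.
    by lia.
Qed.

End Soundness.

Lemma foldl_inv (T : Type) (X : eqType) (P : T -> Prop) (f : T -> X -> T) a l :
  P a -> (forall a x, x \in l -> P a -> P (f a x)) -> P (foldl f a l).
Proof.
elim: l a => //= x l IH a Pa Hf; apply: IH; first by apply: Hf; rewrite ?mem_head.
by move=> b y yl; apply: Hf; rewrite inE yl orbT.
Qed.

(** * Retrieval costs as attained minima *)

Section RetrievalCost.
Variables (V : finType) (G : version_graph V) (M : {set V}) (F : {set V * V}).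

Lemma retrieval_costP v : (exists x p, retrieval_path M F v x p) ->
  is_retrieval_cost G M F v (retrieval_cost G M F v).
Proof.
move=> [x [p Hp]]; apply: classical_sets.xgetPex.
pose P k := boolp.asbool (exists x p, retrieval_path M F v x p /\ path_cost G x p = k).
have exP : exists k, P k by exists (path_cost G x p); apply/boolp.asboolP; exists x, p.
exists (ex_minn exP); case: ex_minnP => k /boolp.asboolP Hk minP; split=> // y q Hq.
by apply: minP; apply/boolp.asboolP; exists y, q.
Qed.

Lemma retrieval_cost_le v x p : retrieval_path M F v x p ->
  retrieval_cost G M F v <= path_cost G x p.
Proof. by move=> Hp; case: (@retrieval_costP v) => [|_]; [exists x, p | apply]. Qed.

End RetrievalCost.

(** Nothing forbids repetitions in [cM] and [cF], but a repetition only raises the storage that is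
    charged. *)
Lemma sum_set_seq_le (T : finType) (f : T -> nat) (s : seq T) :
  \sum_(x in [set y in s]) f x <= \sum_(x <- s) f x.
Proof.
rewrite (eq_bigl [in undup s]) => [|x]; last by rewrite inE mem_undup.
rewrite -big_uniq ?undup_uniq //=.
elim: s => [|x s IH] /=; first by rewrite !big_nil.
case: ifP => _; rewrite !big_cons; first exact: leq_trans IH (leq_addl _ _).
by rewrite leq_add2l.
Qed.

Section Invariant.
Variables (V : finType) (G : version_graph V) (root : V) (B Q m : nat).
Hypothesis G_sym : symmetric (edge G).
Notation sound := (sound G B Q m).
Implicit Types (L : seq (cand V)) (Cl : V -> {set V}).

Definition all_sound Cl L : Prop :=
  uniq [seq c.1 | c <- L] /\ forall c, c \in L -> sound (Cl (cv c)) c.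

Lemma all_sound_ins Cl L c :
  all_sound Cl L -> sound (Cl (cv c)) c -> all_sound Cl (ins L c).
Proof.
move=> HL Hc; apply: (@foldl_ins_ind V (fun c => sound (Cl (cv c)) c) L [:: c]) => //.
by move=> x; rewrite inE => /eqP->.
Qed.

Lemma all_sound_foldl_ins Cl L s :
  all_sound Cl L -> (forall c, c \in s -> sound (Cl (cv c)) c) ->
  all_sound Cl (foldl (@ins V) L s).
Proof. by move=> HL Hs; apply: (@foldl_ins_ind V (fun c => sound (Cl (cv c)) c)). Qed.

Lemma init_cand_sound v a : a <= m ->
  sound [set v] ((v, (a, (1, 0))),
    (if a == 0 then 0 else vertex_store G v,
      (0, (if a == 0 then [::] else [:: v], [::])))).
Proof.
move=> am; split; last split=> //.
- exists [set v], (fun _ => 0), 0; rewrite /cv /cdem /csup /= set11 cards1 muln0 addn0.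
  split=> //; split=> //.
  + by move=> x; rewrite inE => /eqP->; apply: route_refl.
  + by move=> x ->.
  + rewrite lt0n /cM /= => /negPf->; exists v; first by rewrite mem_head.
    exact: route_refl.
  + by rewrite big1.
- rewrite /bounded /cM /cF /csup /crho /ccost /= cards1.
  split; [by case: ifP|by []|by []|by rewrite muln1|by rewrite muln0 muln1].
- by rewrite /cM /cF /cst /=; case: ifP; rewrite ?big_cons !big_nil ?addn0.
Qed.

Lemma init_step_sound v L a : a < m -> all_sound (fun x => [set x]) L ->
  all_sound (fun x => [set x]) (init_step G v L a).
Proof. by move=> am HL; apply: all_sound_ins => //; apply: (@init_cand_sound v a.+1). Qed.

Lemma init_start_sound v L : all_sound (fun x => [set x]) L ->
  all_sound (fun x => [set x]) (ins L ((v, (0, (1, 0))), (0, (0, ([::], [::]))))).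
Proof. by move=> HL; apply: all_sound_ins => //; apply: (@init_cand_sound v 0). Qed.

Lemma init_vertex_sound L v : all_sound (fun x => [set x]) L ->
  all_sound (fun x => [set x]) (init_vertex G m L v).
Proof.
move=> HL; apply: foldl_inv (init_start_sound _ HL) _ => L' a.
by rewrite mem_iota; apply: init_step_sound.
Qed.

Lemma init_sound vs : all_sound (fun x => [set x]) (init G m vs).
Proof. by apply: foldl_inv => // L v _; apply: init_vertex_sound. Qed.

(** As fibres of a map to representatives, clusters are disjoint by construction. *)
Definition cluster (rep : V -> V) (v : V) : {set V} := [set y | rep y == v].
Definition join_rep (rep : V -> V) (uw : V * V) (y : V) : V :=
  if rep y == uw.2 then uw.1 else rep y.

Lemma cluster_join rep u w : u != w ->
  cluster (join_rep rep (u, w)) u = cluster rep u :|: cluster rep w.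
Proof.
move=> uw; apply/setP => y; rewrite !inE /join_rep /=.
by case: (eqVneq (rep y) w) => _; rewrite ?eqxx ?orbT ?orbF.
Qed.

Lemma cluster_join_other rep u w v : v != u -> v != w ->
  cluster (join_rep rep (u, w)) v = cluster rep v.
Proof.
move=> vu vw; apply/setP => y; rewrite !inE /join_rep /=.
by case: (eqVneq (rep y) w) => [->|//]; rewrite eq_sym (negPf vu) eq_sym (negPf vw).
Qed.

Lemma cluster_disjoint rep u w : u != w -> [disjoint cluster rep u & cluster rep w].
Proof.
move=> uw; apply/pred0P => y /=; rewrite !inE.
by case: eqP => // ->; apply: negPf.
Qed.

Section Step.
Variables (rep : V -> V) (L : seq (cand V)) (u w : V).
Hypotheses (uw : u != w) (euw : edge G u w) (L_sound : all_sound (cluster rep) L).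
Notation Cl := (cluster (join_rep rep (u, w))).

Lemma offers2_sound c1 c2 : c1 \in L -> cv c1 = w -> c2 \in L -> cv c2 = u ->
  forall c, c \in attach G B Q u w c2 c1 -> sound (Cl (cv c)) c.
Proof.
move=> L1 c1w L2 c2u c Hc.
case: L_sound => _ Ls; have := Ls c1 L1; have := Ls c2 L2; rewrite c1w c2u => S2 S1.
have [||-> Sc] := attach_sound (cluster_disjoint rep uw) _ _ S2 S1 c2u c1w Hc => //.
  by rewrite G_sym.
by rewrite cluster_join.
Qed.

Lemma step2_sound c1 acc c2 : c1 \in L -> cv c1 = w -> c2 \in L ->
  all_sound Cl acc -> all_sound Cl (step2 G B Q (u, w) c1 acc c2).
Proof.
move=> L1 c1w L2 Hacc; rewrite /step2 /=; case: eqP => // c2u.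
by apply: all_sound_foldl_ins => //; apply: offers2_sound.
Qed.

Lemma step1_sound acc c1 : c1 \in L -> all_sound Cl acc ->
  all_sound Cl (step1 G B Q (u, w) L acc c1).
Proof.
move=> L1 Hacc; rewrite /step1 /=; case: eqP => [c1w|/eqP c1w].
  by apply: foldl_inv => // acc' c2 L2; apply: step2_sound.
case: ifPn => // c1u; apply: all_sound_ins => //.
by rewrite cluster_join_other //; case: L_sound => _; apply.
Qed.

Lemma step_sound : all_sound Cl (step G B Q L (u, w)).
Proof. by apply: foldl_inv => // acc c1 L1; apply: step1_sound. Qed.

End Step.

(** Every representative is a vertex not yet eliminated, so in the end [root] represents all
    vertices. *)
Lemma dp_sound_rep o rep L :
  elim_order (edge G) root o -> (forall y, rep y \in visited root o) ->
  all_sound (cluster rep) L -> all_sound (cluster (fun _ => root)) (foldl (step G B Q) L o).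
Proof.
elim: o rep L => [|[u w] o IH] rep L /=.
  move=> _ Hrep; have -> // : cluster rep = cluster (fun _ => root).
  apply/boolp.funext => v; apply/setP => y; rewrite !inE.
  by have := Hrep y; rewrite mem_seq1 => /eqP->.
move=> [w_o u_o euw _ Ho] Hrep HL.
have uw : u != w by apply: contraNneq w_o => <-.
apply: (IH (join_rep rep (u, w))) => //; last exact: step_sound.
move=> y; rewrite /join_rep /=; case: eqP => // rw.
by have := Hrep y; rewrite visited_cons; case: eqP.
Qed.

(** Keys are distinct and their components have small ranges; storage and exact cost, which can be
    huge, are not part of the key. *)
Lemma size_all_sound Cl L : all_sound Cl L ->
  size L <= #|V| * (m.+1 * (#|V|.+1 * (Q * #|V|).+1)).
Proof.
move=> [UL HL]; rewrite -(size_map fst).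
pose K := [seq (v, t) | v <- enum V, t <- [seq (a, p) | a <- iota 0 m.+1,
   p <- [seq (b, r) | b <- iota 0 #|V|.+1, r <- iota 0 (Q * #|V|).+1]]].
suff sub : {subset [seq c.1 | c <- L] <= K}.
  by apply: leq_trans (uniq_leq_size UL sub) _; rewrite !size_allpairs !size_iota -cardE.
move=> _ /mapP[c /HL[[Dep [D [h [_ sub cDep _]]]] [_ _ b1 b2 _] _] ->].
have card : #|Cl (cv c)| <= #|V| by apply: max_card.
have dem : cdem c <= #|V| by rewrite -cDep max_card.
have rho : crho c <= Q * #|V|.
  apply: leq_trans (leq_mul (leqnn Q) card); apply: leq_trans b2; exact: leq_addr.
move: b1 dem rho; rewrite /csup /cdem /crho.
case: c.1 => v [a [b r]] /= b1 dem rho.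
by apply: allpairs_f; [rewrite mem_enum | apply: allpairs_f; [|apply: allpairs_f]];
  rewrite ?mem_iota ?add0n ?ltnS.
Qed.

Lemma all_sound_small Cl L c : all_sound Cl L -> c \in L ->
  [/\ csup c <= m, cdem c <= #|V|, size (cM c) <= #|V| & size (cF c) <= #|V|].
Proof.
move=> [_ HL] /HL[[Dep [D [h [_ sub cDep _]]]] [b1 b2 b3 _ _] _].
have card : #|Cl (cv c)| <= #|V| by apply: max_card.
split=> //; first by rewrite -cDep max_card.
  exact: leq_trans b1 card.
exact: leq_trans (ltnW b2) card.
Qed.

(** When supply meets demand, the charge [csup c * h] provides [h] for every dependent: the distance
    from a materialized vertex to the interface, which its [D x] leaves out. *)
Lemma sound_feasible S c : sound setT c -> csup c = cdem c -> cst c <= S ->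
  feasible G S [set x in cM c] [set x in cF c] /\
  total_retrieval G [set x in cM c] [set x in cF c] <= ccost c.
Proof.
move=> [[Dep [D [h [d1 d2 d3 [d4 d5 d6 d7]]]]] _ [eF st]] supE stS.
set M := [set x in cM c]; set F := [set x in cF c].
have sup0 : 0 < csup c by rewrite supE -d3 card_gt0; apply/set0Pn; exists (cv c).
have route_x x : retrievable G (cM c) (cF c) x (D x + (x \in Dep) * h).
  case: (boolP (x \in Dep)) => xD; last by rewrite mul0n addn0; apply: d5; rewrite ?inE.
  by rewrite mul1n addnC; apply: retrievable_route (d6 sup0) (d4 x xD).
have ret_x x : exists2 y, exists p, retrieval_path M F x y p /\
    path_cost G y p = D x + (x \in Dep) * h & True.
  case: (route_x x) => y yM [p [Hp lp cp]]; exists y => //; exists p; split=> //.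
  split=> //; first by rewrite inE.
  by apply: sub_path Hp => a b; rewrite inE.
split; first split.
- split; first by move=> e; rewrite inE; apply: eF.
  by move=> x; case: (ret_x x) => y [p [Hp _]] _; exists y, p.
- apply: leq_trans stS; apply: leq_trans st.
  by apply: leq_add; apply: sum_set_seq_le.
have sumD : \sum_(x : V) (x \in Dep) * h = cdem c * h.
  by rewrite -big_distrl /= -d3 -sum1_card [in RHS]big_mkcond; congr (_ * _);
    apply: eq_bigr => x _; case: (x \in Dep).
apply: leq_trans d7; rewrite supE -sumD (eq_bigl predT); last by move=> x; rewrite inE.
rewrite -big_split /=; apply: leq_sum => x _.
by case: (ret_x x) => y [p [Hp <-]] _; apply: retrieval_cost_le.
Qed.

End Invariant.

(** * Completeness of the dynamic program *)

Lemma sum_indicator (V : finType) (f : V -> nat) x :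
  \sum_c (c == x) * f c = f x.
Proof.
rewrite (bigD1 x) //= eqxx mul1n big1 ?addn0 // => c /negPf->.
by rewrite mul0n.
Qed.

Section Completeness.
Variables (V : finType) (G : version_graph V) (root : V) (B Q m : nat).
Hypothesis G_sym : symmetric (edge G).
(* par sends a vertex to the one it is retrieved from, and materialized
   vertices to themselves; N v is the number of vertices retrieved through v. *)
Variables (par : V -> V) (hgt N : V -> nat).
Hypothesis par_edge : forall v, par v != v -> edge G (par v) v.
Hypothesis par_hgt : forall v, par v != v -> hgt (par v) < hgt v.
Hypothesis N_rec : forall v, N v = 1 + \sum_(c | (par c == v) && (c != v)) N c.
Hypothesis N_le : forall v, N v <= m.
Hypothesis B_ge : forall c, par c != c -> N c * edge_ret G (par c) c <= B.

(** This is the supply that the fixed solution induces on the cluster of [v] while the vertices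
    visited by [o] remain: flow has arrived if [v] is materialized or its parent is already in the
    cluster. The demand [cut_dem] counts [v] and the flow to its eliminated children. *)
Definition cut_sup (o : seq (V * V)) v :=
  if (par v == v) || (par v \notin visited root o) then N v else 0.
Definition cut_dem (o : seq (V * V)) v :=
  1 + \sum_(c | [&& par c == v, c != v & c \notin visited root o]) N c.
Definition pending (o : seq (V * V)) c :=
  [&& par c != c, c \in visited root o & par c \in visited root o].

(** Conservation: what the remaining vertices have collected and what the pending edges will still
    add make up the total. It serves for rounded costs and storage alike. *)
Definition traced (A0 A : V -> nat) o (f : V -> nat) : Prop :=
  \sum_(v | v \in visited root o) f v + \sum_(c | pending o c) A c =
  \sum_v A0 v + \sum_(c | par c != c) A c.

Lemma par_no2cycle a b : par a = b -> a != b -> par b != a.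
Proof.
move=> ab aNb; apply/eqP => ba.
have := @par_hgt a; have := @par_hgt b; rewrite ab ba aNb eq_sym aNb.
by move=> /(_ isT) H1 /(_ isT) H2; lia.
Qed.

Section Step.
Variables (u w : V) (o : seq (V * V)).
Hypothesis w_o : w \notin visited root o.
Hypothesis u_o : u \in visited root o.
Hypothesis leaf : {in visited root o, forall x, edge G x w -> x = u}.

Let uw : u != w. Proof. by apply: contraNneq w_o => <-. Qed.
Let vis x : (x \in visited root ((u, w) :: o)) = (x == w) || (x \in visited root o).
Proof. exact: visited_cons. Qed.

Let par_w : par w != w -> par w \in visited root o -> par w = u.
Proof. by move=> /par_edge e Hw; apply: leaf. Qed.

Let par_to_w c : par c = w -> c != w -> c \in visited root o -> c = u.
Proof.
move=> cw cNw c_o; apply: leaf => //; rewrite G_sym -cw; apply: par_edge.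
by rewrite cw eq_sym.
Qed.

(** As [w] is a leaf, only the edge between [u] and [w] can stop being pending, in whichever
    direction retrieval uses it. *)
Lemma pending_step c : pending ((u, w) :: o) c =
  pending o c + ((c == w) && (par w == u)) + ((c == u) && (par u == w)) :> nat.
Proof.
have uNw := uw; rewrite /pending !vis; case: (eqVneq (par c) c) => [pc|pc] /=.
  case: (eqVneq c w) => [cw|cw]; case: (eqVneq c u) => [cu|cu] //=.
  - by rewrite -cu cw eqxx in uNw.
  - by rewrite -cw pc (negPf cu).
  - by rewrite -cu pc (negPf cw).
case: (eqVneq c w) => [cw|cw].
  move: pc; rewrite cw (negPf w_o) [w == u]eq_sym (negPf uNw) => pw /=.
  rewrite addn0 (negPf pw) add0n /=; congr nat_of_bool.
  by apply/idP/eqP => [/(par_w pw)//|->].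
rewrite /= addn0; case: (eqVneq c u) => [->|cu] /=.
  by rewrite u_o; case: (eqVneq (par u) w) => [->|_] /=; rewrite ?(negPf w_o) ?addn0.
rewrite addn0; case: (boolP (c \in _)) => //= c_o.
by case: (eqVneq (par c) w) => // /par_to_w /(_ cw c_o) /eqP; rewrite (negPf cu).
Qed.

Lemma traced_step A0 A f :
  let t := if par w == u then A w else if par u == w then A u else 0 in
  traced A0 A ((u, w) :: o) f ->
  traced A0 A o (fun v => if v == u then f u + f w + t else f v).
Proof.
move=> t; rewrite /traced => <-.
have -> : \sum_(c | pending ((u, w) :: o) c) A c = \sum_(c | pending o c) A c + t.
  rewrite big_mkcond [in RHS]big_mkcond /=.
  transitivity (\sum_c ((if pending o c then A c else 0) +
     ((c == w) * ((par w == u) * A c) + (c == u) * ((par u == w) * A c)))).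
    apply: eq_bigr => c _; have := pending_step c.
    case: (pending _ c) (pending o c) (c == w) (c == u) (par w == u) (par u == w)
      => [] [] [] [] [] [] //=; lia.
  rewrite !big_split /= !sum_indicator; congr (_ + _).
  rewrite /t; case: (eqVneq (par w) u) => [pw|_]; last by case: eqP; lia.
  by rewrite (negPf (par_no2cycle pw _)) 1?eq_sym // mul1n addn0.
rewrite (bigD1 u) //= eqxx [in RHS](bigD1 w) ?vis ?eqxx //=.
rewrite [in RHS](bigD1 u) ?vis ?u_o ?uw ?orbT //=.
set S1 := \sum_(i in _ | _) _; set S2 := \sum_(i | _) _; set P := \sum_(i | _) _.
suff -> : S1 = P by lia.
rewrite /S1 /P (eq_bigr f) => [|x /andP[_ /negPf->]] //; apply: eq_bigl => x.
rewrite vis; case: (eqVneq x w) => [->|] //=; last by rewrite andbT.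
by rewrite (negPf w_o).
Qed.

Lemma cut_sup_other v : v \in visited root o -> v != u ->
  cut_sup o v = cut_sup ((u, w) :: o) v.
Proof.
move=> v_o vu; rewrite /cut_sup vis negb_or.
case: (eqVneq (par v) w) => //= pv.
have vw : v != w by apply: contraNneq w_o => <-.
by rewrite (par_to_w pv vw v_o) eqxx in vu.
Qed.

Lemma cut_dem_other v : v \in visited root o ->
  cut_dem o v = cut_dem ((u, w) :: o) v + ((v == u) && (par w == u)) * N w.
Proof.
move=> v_o; rewrite /cut_dem -addnA; congr (1 + _).
have vw : v != w by apply: contraNneq w_o => <-.
have -> : (v == u) && (par w == u) = (par w == v).
  apply/andP/eqP => [[/eqP-> /eqP]//|pw].
  have /par_w : par w != w by rewrite pw.
  by rewrite pw => /(_ v_o) ->; rewrite eqxx.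
case: (eqVneq (par w) v) => [pw|pw].
  rewrite (bigD1 w) /=; last by rewrite pw eqxx eq_sym vw w_o.
  rewrite mul1n addnC; congr (_ + _); apply: eq_bigl => c.
  by rewrite vis negb_or; do !case: (_ == _); case: (_ \in _).
rewrite mul0n addn0; apply: eq_bigl => c; rewrite vis negb_or.
by case: (eqVneq c w) => [->|//]; rewrite (negPf pw).
Qed.

(** All children of the leaf [w] other than [u] have been eliminated, so its demand falls short of
    [N w] by exactly what it sends to [u]. *)
Lemma cut_dem_leaf :
  cut_dem ((u, w) :: o) w + (par u == w) * N u = N w.
Proof.
rewrite /cut_dem [RHS]N_rec -addnA; congr (1 + _).
rewrite [RHS](bigID (fun c => c \notin visited root ((u, w) :: o))) /=.
congr (_ + _); first by apply: eq_bigl => c; rewrite andbA.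
rewrite -(sum_indicator (fun c => (par c == w) * N c)) [RHS]big_mkcond.
apply: eq_bigr => c _; rewrite vis negbK.
case: (eqVneq (par c) w) => [pc|_] /=; last by rewrite muln0.
case: (eqVneq c w) => [->|cw] /=; first by rewrite eq_sym (negPf uw).
case: (boolP (c \in _)) => c_o; first by rewrite (par_to_w pc cw c_o) eqxx !mul1n.
by case: eqP c_o => // ->; rewrite u_o.
Qed.

Lemma cut_sup_leaf : cut_sup ((u, w) :: o) w = if par w == u then 0 else N w.
Proof.
rewrite /cut_sup vis; case: (eqVneq (par w) w) => [->|pw] /=.
  by rewrite eq_sym (negPf uw).
case: (eqVneq (par w) u) => [->|pu]; first by rewrite u_o.
by case: (boolP (par w \in _)) => // /(par_w pw) /eqP; rewrite (negPf pu).
Qed.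

Lemma cut_sup_node :
  cut_sup o u = if par u == w then N u else cut_sup ((u, w) :: o) u.
Proof.
rewrite /cut_sup vis; case: (eqVneq (par u) w) => [->|] //=.
by rewrite w_o orbT.
Qed.

Lemma cut_sup_node_par : par u = w -> cut_sup ((u, w) :: o) u = 0.
Proof. by move=> pu; rewrite /cut_sup vis pu eqxx eq_sym (negPf uw). Qed.

End Step.

Definition rounded c := quot B Q (N c * edge_ret G (par c) c).
Definition edge_cost c := edge_store G (par c) c.
Definition vertex_cost v := if par v == v then vertex_store G v else 0.

Definition reached o (L : seq (cand V)) (rf sf : V -> nat) : Prop :=
  forall v, v \in visited root o -> exists2 c, c \in L &
    c.1 = (v, (cut_sup o v, (cut_dem o v, rf v))) /\ cst c <= sf v.

Lemma comb_ex (cu cw : cand V) sup dem j s r (Fe : seq (V * V)) : j * r <= B ->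
  exists2 c, c \in comb B Q cu cw sup dem j s r Fe &
    c.1 = (cv cu, (sup, (dem, crho cu + crho cw + quot B Q (j * r)))) /\
    cst c = cst cu + cst cw + s.
Proof. by move=> jr; rewrite /comb jr; eexists; first exact: mem_head. Qed.

Lemma N_gt0 v : 0 < N v.
Proof. by rewrite N_rec. Qed.

Definition new_edge (u w : V) (A : V -> nat) : nat :=
  if par w == u then A w else if par u == w then A u else 0.

Lemma attach_ex u w o (cu cw : cand V) rf sf :
  w \notin visited root o -> u \in visited root o ->
  {in visited root o, forall x, edge G x w -> x = u} ->
  cu.1 = (u, (cut_sup ((u, w) :: o) u, (cut_dem ((u, w) :: o) u, rf u))) ->
  cw.1 = (w, (cut_sup ((u, w) :: o) w, (cut_dem ((u, w) :: o) w, rf w))) ->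
  cst cu <= sf u -> cst cw <= sf w ->
  exists2 c, c \in attach G B Q u w cu cw &
    c.1 = (u, (cut_sup o u, (cut_dem o u, rf u + rf w + new_edge u w rounded))) /\
    cst c <= sf u + sf w + new_edge u w edge_cost.
Proof.
move=> w_o u_o leaf uE wE us ws.
have uw : u != w by apply: contraNneq w_o => <-.
have demw := cut_dem_leaf w_o u_o leaf; have supw := cut_sup_leaf w_o u_o leaf.
have supu := cut_sup_node u w_o; have demu := cut_dem_other w_o leaf u_o.
move: demu; rewrite eqxx /= => demu.
have [su du] : csup cu = cut_sup ((u, w) :: o) u /\ cdem cu = cut_dem ((u, w) :: o) u.
  by rewrite /csup /cdem uE.
have [sw dw] : csup cw = cut_sup ((u, w) :: o) w /\ cdem cw = cut_dem ((u, w) :: o) w.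
  by rewrite /csup /cdem wE.
rewrite /attach /new_edge su du sw dw.
have cvu : cv cu = u by rewrite /cv uE.
have rhou : crho cu = rf u by rewrite /crho uE.
have rhow : crho cw = rf w by rewrite /crho wE.
rewrite supw supu demu; case: (eqVneq (par w) u) => [pw|pw].
  have pu : (par u == w) = false by rewrite (negPf (par_no2cycle pw _)) // eq_sym.
  move: demw; rewrite pu mul0n addn0 => demw; rewrite eqxx demw mul1n.
  have jr : N w * edge_ret G u w <= B.
    by rewrite -pw; apply: B_ge; rewrite pw.
  have [c Hc [c1 cs]] := comb_ex cu cw (cut_sup ((u, w) :: o) u)
    (cut_dem ((u, w) :: o) u + N w) (edge_store G u w) [:: (u, w)] jr.
  exists c => //; split; first by rewrite c1 cvu rhou rhow /rounded pw.
  by rewrite cs /edge_cost pw; lia.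
have Nw0 := N_gt0 w; rewrite mul0n addn0; case: eqP => [|_]; first by lia.
case: (eqVneq (par u) w) => [pu|pu]; last first.
  move: demw; rewrite (negPf pu) mul0n addn0 => demw; rewrite demw eqxx.
  have [c Hc [c1 cs]] := comb_ex cu cw (cut_sup ((u, w) :: o) u)
    (cut_dem ((u, w) :: o) u) 0 [::] (leq0n B : 0 * 0 <= B).
  by exists c => //; split; [rewrite c1 cvu rhou rhow mul0n quot0 | rewrite cs; lia].
move: demw; rewrite pu eqxx mul1n; set d := cut_dem _ w => demw; have Nu0 := N_gt0 u.
case: (eqVneq (N w) d) => [Nwd|_]; first by clear -Nwd demw Nu0; lia.
case: ifPn => [_|]; last by lia.
rewrite (cut_sup_node_par w_o u_o pu) eqxx.
rewrite -[X in X - _]demw addKn.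
have jr : N u * edge_ret G w u <= B.
  by rewrite -pu; apply: B_ge; rewrite pu eq_sym.
have [c Hc [c1 cs]] := comb_ex cu cw (N u) (cut_dem ((u, w) :: o) u)
  (edge_store G w u) [:: (w, u)] jr.
exists c => //; split; first by rewrite c1 cvu rhou rhow /rounded pu.
by rewrite cs /edge_cost pu; lia.
Qed.

Definition update (u w : V) (A f : V -> nat) (v : V) :=
  if v == u then f u + f w + new_edge u w A else f v.

Lemma reached_step u w o L rf sf : elim_order (edge G) root ((u, w) :: o) ->
  reached ((u, w) :: o) L rf sf ->
  reached o (step G B Q L (u, w)) (update u w rounded rf) (update u w edge_cost sf).
Proof.
move=> [w_o u_o _ leaf _] HL v v_o; rewrite /update.
case: (eqVneq v u) => [->|vu].
  have [cu Lu [u1 us]] : exists2 c, c \in L &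
      c.1 = (u, (cut_sup ((u, w) :: o) u, (cut_dem ((u, w) :: o) u, rf u))) /\ cst c <= sf u.
    by apply: HL; rewrite visited_cons u_o orbT.
  have [cw Lw [w1 ws]] : exists2 c, c \in L &
      c.1 = (w, (cut_sup ((u, w) :: o) w, (cut_dem ((u, w) :: o) w, rf w))) /\ cst c <= sf w.
    by apply: HL; rewrite visited_cons eqxx.
  have [c Hc [c1 cs]] := attach_ex w_o u_o leaf u1 w1 us ws.
  have [||z Lz [z1 zs]] := step_attach Lw Lu _ _ Hc.
  - by rewrite /cv w1.
  - by rewrite /cv u1.
  by exists z => //; rewrite z1; split=> //; apply: leq_trans zs cs.
have [c Lc [c1 cs]] : exists2 c, c \in L &
    c.1 = (v, (cut_sup ((u, w) :: o) v, (cut_dem ((u, w) :: o) v, rf v))) /\ cst c <= sf v.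
  by apply: HL; rewrite visited_cons v_o orbT.
have vw : v != w by apply: contraNneq w_o => <-.
have [||z Lz [z1 zs]] := @step_keep V G B Q L u w c Lc.
- by rewrite /cv c1.
- by rewrite /cv c1.
exists z => //; rewrite z1 c1 (cut_sup_other w_o leaf v_o vu).
rewrite (cut_dem_other w_o leaf v_o) (negPf vu) mul0n addn0.
by split=> //; apply: leq_trans zs cs.
Qed.

Lemma reached_dp o L rf sf A0 A0' : elim_order (edge G) root o ->
  reached o L rf sf -> traced A0 rounded o rf -> traced A0' edge_cost o sf ->
  exists2 c, c \in foldl (step G B Q) L o &
    c.1 = (root, (N root, (N root,
      \sum_v A0 v + \sum_(c | par c != c) rounded c))) /\
    cst c <= \sum_v A0' v + \sum_(c | par c != c) edge_cost c.
Proof.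
elim: o L rf sf => [|[u w] o IH] L rf sf Ho HL Hr Hs /=.
  have [c Lc [c1 cs]] := HL root (mem_head _ _).
  have vis x : (x \in visited root [::]) = (x == root) by rewrite mem_seq1.
  have pend (A : V -> nat) : \sum_(c | pending [::] c) A c = 0.
    apply: big1 => x; rewrite /pending !vis => /and3P[px /eqP xr].
    by rewrite xr in px *; rewrite (negPf px).
  have sum1 (f : V -> nat) : \sum_(v | v \in visited root [::]) f v = f root.
    by rewrite (eq_bigl _ _ vis) big_pred1_eq.
  move: Hr Hs; rewrite /traced !pend !sum1 !addn0 => Hr Hs.
  exists c => //; rewrite -Hr -Hs; split=> //; rewrite c1 /cut_sup /cut_dem vis.
  have -> : (par root == root) || (par root != root) by case: eqP.
  congr (_, (_, (_, _))); rewrite [RHS]N_rec; congr (1 + _); apply: eq_bigl => x.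
  by rewrite vis andbA -[RHS]andbb; case: eqP; case: eqP.
case: (Ho) => w_o u_o _ leaf Ho'.
apply: IH Ho' (reached_step Ho HL) _ _.
- exact: (traced_step w_o u_o leaf Hr).
- exact: (traced_step w_o u_o leaf Hs).
Qed.

Lemma foldl_hit (T : Type) (X : eqType) (P : T -> Prop) (f : T -> X -> T) a l x :
  x \in l -> (forall a, P (f a x)) -> (forall a y, P a -> P (f a y)) ->
  P (foldl f a l).
Proof.
move=> xl Hx Hf; elim: l a xl => //= y l IH a; rewrite inE => /orP[/eqP<-|]; last exact: IH.
by apply: foldl_inv => // b z _; apply: Hf.
Qed.

Lemma foldl_dominates (X : Type) (f : seq (cand V) -> X -> seq (cand V)) l L c :
  (forall L a, dominates L c -> dominates (f L a) c) -> dominates L c ->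
  dominates (foldl f L l) c.
Proof. by move=> Hf; elim: l L => //= a l IH L HL; apply: IH; apply: Hf. Qed.

Lemma init_vertex_dominates (L : seq (cand V)) v c :
  dominates L c -> dominates (init_vertex G m L v) c.
Proof.
move=> H; apply: foldl_dominates => [L' a H'|]; apply: ins_dominates; right => //.
Qed.

Lemma init_reached vs v : v \in vs -> exists2 c, c \in init G m vs &
  c.1 = (v, (if par v == v then N v else 0, (1, 0))) /\ cst c <= vertex_cost v.
Proof.
move=> vvs; rewrite /vertex_cost.
pose c0 : cand V := ((v, (if par v == v then N v else 0, (1, 0))),
  (if par v == v then vertex_store G v else 0,
    (0, (if par v == v then [:: v] else [::], [::])))).
suff [z Lz [z1 zs]] : dominates (init G m vs) c0 by exists z.
refine (foldl_hit (P := (dominates (V := V))^~ c0) _ vvs _ _) => [L|L a];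
  last exact: init_vertex_dominates.
rewrite /init_vertex {}/c0; case: eqP => pv; last first.
  apply: foldl_dominates => [L' a H|]; apply: ins_dominates; [by right|by left].
(* [init_step] adds one to its index, so the supply [N v] arises at index [(N v).-1]. *)
refine (foldl_hit (P := (dominates (V := V))^~ _) (x := (N v).-1) _ _ _ _) => [|L'|L' a H].
- by rewrite mem_iota add0n; have := N_gt0 v; have := N_le v; lia.
- by apply: ins_dominates; left; rewrite prednK ?N_gt0.
- by apply: ins_dominates; right.
Qed.

Lemma dp_complete vs o : elim_order (edge G) root o ->
  (forall x, x \in visited root o) -> (forall x, x \in vs) ->
  exists2 c, c \in dp G B Q m vs o &
    c.1 = (root, (N root, (N root, \sum_(c | par c != c) rounded c))) /\
    cst c <= \sum_v vertex_cost v + \sum_(c | par c != c) edge_cost c.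
Proof.
move=> Ho vis Hvs.
have full (A A0 : V -> nat) : traced A0 A o A0.
  rewrite /traced; congr (_ + _); apply: eq_bigl => c; first by rewrite vis.
  by rewrite /pending !vis !andbT.
have HL : reached o (init G m vs) (fun _ => 0) vertex_cost.
  move=> v _; have [c Lc [c1 cs]] := init_reached (Hvs v); exists c => //; split=> //.
  rewrite c1 /cut_sup vis orbF /cut_dem big1 // => x.
  by rewrite vis !andbF.
have := reached_dp Ho HL (full rounded _) (full edge_cost _).
by rewrite big1.
Qed.

End Completeness.

(** * The approximation ratio *)

Section Forest.
Variables (V : finType) (par : V -> V) (hgt : V -> nat).
Hypothesis par_hgt : forall v, par v != v -> hgt (par v) < hgt v.

Fixpoint num_served (k : nat) (v : V) : nat :=
  if k is k'.+1 then 1 + \sum_(c | (par c == v) && (c != v)) num_served k' c else 0.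

(** Heights grow from parents to children, so the unrolling is stable once its depth exceeds the
    largest height. *)
Lemma num_served_rec : exists N : V -> nat,
  forall v, N v = 1 + \sum_(c | (par c == v) && (c != v)) N c.
Proof.
pose H := \max_v hgt v.
have stable k v : H < k + hgt v -> num_served k.+1 v = num_served k v.
  elim: k v => [|k IH] v.
    by rewrite add0n ltnNge (leq_bigmax v).
  move=> Hk; rewrite /= -/num_served; congr (1 + _); apply: eq_bigr => c /andP[/eqP cv cNv].
  have /par_hgt : par c != c by rewrite cv eq_sym.
  by rewrite cv => hv; apply: IH; lia.
exists (num_served H.+1) => v; rewrite -stable //; lia.
Qed.

Variable N : V -> nat.
Hypothesis N_rec : forall v, N v = 1 + \sum_(c | (par c == v) && (c != v)) N c.

(** The recursion for [N], weighted by [g] and summed with the children regrouped. Weight 1 gives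
    the bound on [N], and the retrieval cost as weight gives the flow form of the objective. *)
Lemma sum_children (g : V -> nat) :
  \sum_v g v * N v = \sum_v g v + \sum_(c | par c != c) g (par c) * N c.
Proof.
rewrite (eq_bigr (fun v => g v + \sum_(c | (par c != c) && (par c == v)) g (par c) * N c)).
  by rewrite big_split -partition_big.
move=> v _; rewrite [in LHS]N_rec mulnDr muln1 big_distrr /=; congr (_ + _).
apply: eq_big => [c|c /andP[/eqP-> _] //].
by case: (eqVneq (par c) v) => [->|_]; rewrite ?andbF // andbT eq_sym.
Qed.

(** [N] does not decrease towards a root, and [sum_children] with weight 1 shows that its values at
    the roots sum to [#|V|]. *)
Lemma num_served_le v : N v <= #|V|.
Proof.
have roots u : par u = u -> N u <= #|V|.
  move=> pu; have := sum_children (fun _ => 1).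
  rewrite sum1_card; under eq_bigr do rewrite mul1n.
  under [in RHS]eq_bigr do rewrite mul1n.
  rewrite (bigID (fun c => par c != c)) /= addnC => /addIn <-.
  by rewrite (bigD1 u) /= ?pu ?eqxx // leq_addr.
elim: (hgt v).+1 {-2}v (ltnSn (hgt v)) => // k IH u uk.
case: (eqVneq (par u) u) => [/roots//|pu].
have le_par : N u <= N (par u).
  by rewrite [N (par u)]N_rec (bigD1 u) /= ?eqxx 1?eq_sym //; lia.
by apply: leq_trans le_par (IH _ _); apply: leq_trans (par_hgt pu) _.
Qed.

(** In [sum_children] with weight [R], expanding [R c] as [R (par c) + r c] makes the terms
    [R (par c) * N c] cancel. *)
Lemma sum_flow (R r : V -> nat) : (forall v, par v = v -> R v = 0) ->
  (forall v, par v != v -> R v = R (par v) + r v) ->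
  \sum_v R v = \sum_(c | par c != c) N c * r c.
Proof.
move=> R0 Rr; apply: (@addIn (\sum_(c | par c != c) R (par c) * N c)).
rewrite -sum_children (bigID (fun c => par c != c)) /= [X in _ + X]big1 ?addn0.
  by rewrite -big_split; apply: eq_bigr => c /Rr->; rewrite mulnDl addnC mulnC.
by move=> c; rewrite negbK => /eqP/R0->.
Qed.

End Forest.

Lemma sum_subset (T : finType) (f : T -> nat) (A B : {set T}) :
  A \subset B -> \sum_(x in A) f x <= \sum_(x in B) f x.
Proof.
by move=> /setIidPr AB; rewrite [in leqRHS](big_setID A) /= AB leq_addr.
Qed.

(** * The forest of cheapest retrieval paths *)

Section RetrievalForest.
Variables (V : finType) (G : version_graph V) (M : {set V}) (F : {set V * V}).
Hypothesis G_irr : irreflexive (edge G).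
Hypothesis MF : solution G M F.
Notation R := (retrieval_cost G M F).

(* Among the cheapest retrieval paths one with the fewest edges is taken, so
   that cycles of edges with retrieval cost 0 cannot occur. *)
Lemma shortest_retrieval v : exists xp : V * seq V,
  [/\ retrieval_path M F v xp.1 xp.2, path_cost G xp.1 xp.2 = R v &
      forall y q, retrieval_path M F v y q -> path_cost G y q = R v ->
        size xp.2 <= size q].
Proof.
case: MF => _ sol; have [[x [p [Hp cp]]] _] := retrieval_costP G (sol v).
pose P k := boolp.asbool (exists x p,
  [/\ retrieval_path M F v x p, path_cost G x p = R v & size p = k]).
have exP : exists k, P k by exists (size p); apply/boolp.asboolP; exists x, p.
have := ex_minnP exP; case=> k /boolp.asboolP[y [q [Hq cq <-]]] minP.
exists (y, q); split=> // z s Hs cs.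
by apply: minP; apply/boolp.asboolP; exists z, s.
Qed.

(** The parent of [v] is the last vertex but one on its chosen path, and the height is the number of
    edges. A prefix of a cheapest path is cheapest, so the path chosen for the parent has no more
    edges than the prefix. *)
Lemma retrieval_forest : exists (par : V -> V) (hgt : V -> nat),
  [/\ forall v, par v = v -> v \in M /\ R v = 0,
      forall v, par v != v -> (par v, v) \in F,
      forall v, par v != v -> R v = R (par v) + edge_ret G (par v) v &
      forall v, par v != v -> hgt (par v) < hgt v].
Proof.
have [f Hf] := fin_all_exists shortest_retrieval.
have eF a b : (a, b) \in F -> a != b.
  by case: MF => /(_ (a, b)) sF _ /sF; rewrite inE /=; apply: contraTneq => ->; rewrite G_irr.
(* [belast] drops the end of the path and [behead] its start, which returns as the default of
   [last]. For the path of length 0 this gives [v] itself. *)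
pose par v := last (f v).1 (behead (belast (f v).1 (f v).2)).
exists par, (fun v => size (f v).2).
have [cost0 step] : (forall v, par v = v -> v \in M /\ R v = 0) /\
  (forall v, par v != v -> [/\ (par v, v) \in F, R v = R (par v) + edge_ret G (par v) v &
     size (f (par v)).2 < size (f v).2]).
  suff H v : (par v = v /\ (v \in M /\ R v = 0)) \/
      (par v != v /\ [/\ (par v, v) \in F, R v = R (par v) + edge_ret G (par v) v &
        size (f (par v)).2 < size (f v).2]).
    split=> v pv; case: (H v) => [[pv' //]|[pv' //]].
      by rewrite pv eqxx in pv'.
    by rewrite pv' eqxx in pv.
  have [Hp cp minp] := Hf v; rewrite /par; move: Hp cp minp.
  case: (f v) => x p /=; case/lastP: p => [|p y] [xM Hp lp] cp minp.
    by left; rewrite /= in lp; rewrite -cp -lp.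
  rewrite last_rcons in lp; rewrite belast_rcons /=; move: Hp; rewrite rcons_path.
  move=> /andP[Hp pF]; set z := last x p in pF *; right; rewrite lp in pF.
  have Hz : retrieval_path M F z x p by [].
  have Rz_le := retrieval_cost_le G Hz.
  have [Hq cq minq] := Hf z.
  have extend a q : retrieval_path M F z a q -> retrieval_path M F v a (rcons q v).
    by case=> aM Hq' lq; split; rewrite ?rcons_path ?last_rcons // Hq' lq.
  have cost_rcons a q : last a q = z ->
      path_cost G a (rcons q v) = path_cost G a q + edge_ret G z v.
    by move=> lq; rewrite /path_cost -cats1 pairmap_cat sumn_cat lq /= addn0.
  have Rv_le : R v <= R z + edge_ret G z v.
    by rewrite -cq -cost_rcons; [apply: retrieval_cost_le; apply: extend | case: Hq].
  have Rv : R v = path_cost G x p + edge_ret G z v by rewrite -cp lp cost_rcons.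
  split; first exact: eF.
  have Rz : path_cost G x p = R z by lia.
  split=> //; first by rewrite Rv Rz.
  by rewrite size_rcons ltnS (minq x p).
split=> // v /step[] //.
Qed.

Lemma forest_storage (par : V -> V) :
  (forall v, par v = v -> v \in M) -> (forall v, par v != v -> (par v, v) \in F) ->
  \sum_v vertex_cost G par v + \sum_(c | par c != c) edge_cost G par c
    <= storage_cost G M F.
Proof.
move=> parM parF; apply: leq_add.
  rewrite /vertex_cost -big_mkcond /= [leqRHS]big_mkcond [leqLHS]big_mkcond /=.
  by apply: leq_sum => v _; case: eqP => // /parM ->.
pose g c := (par c, c).
have -> : \sum_(c | par c != c) edge_cost G par c =
    \sum_(e in [set g c | c in [set c | par c != c]]) edge_store G e.1 e.2.
  (* The second component recovers [c], so no stored edge is counted twice. *)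
  rewrite big_imset; last by move=> a b _ _ [].
  by apply: eq_bigl => c; rewrite inE.
apply: sum_subset; apply/subsetP => e /imsetP[c]; rewrite inE => /parF cF ->.
exact: cF.
Qed.

End RetrievalForest.

(** * Correctness of the search over all guesses *)

Section Solve.
Variables (V : finType) (G : version_graph V) (root : V) (k m S : nat).
Variables (vs : seq V) (es : seq (V * V)).
Hypothesis G_tree : bidirectional_tree G.
Hypothesis mE : m = #|V|.
Hypothesis vsE : forall v, v \in vs.
Hypothesis esE : forall u w, ((u, w) \in es) = edge G u w.

(** The guess is existential because candidates of different guesses compete; the winner only has to
    be sound for its own. *)
Definition valid (c : cand V) : Prop :=
  [/\ cv c = root, csup c = cdem c, cst c <= S & exists B Q, sound G B Q m setT c].

Definition beats (best : seq (cand V)) (c : cand V) : Prop :=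
  if best is b :: _ then ccost b <= ccost c else False.

Lemma select_valid best c : (forall b, b \in best -> valid b) ->
  (cv c = root -> exists B Q, sound G B Q m setT c) ->
  forall b, b \in select_step root S best c -> valid b.
Proof.
rewrite /select_step => Hbest Hc b; do 3![case: ifP => [?|_]; last exact: Hbest].
have Hv : valid c by split; [exact/eqP|exact/eqP|by []|apply: Hc; exact/eqP].
case: best Hbest => [|b' best] Hbest; first by rewrite mem_seq1 => /eqP->.
by case: ifP => _; [apply: Hbest | rewrite mem_seq1 => /eqP->].
Qed.

Lemma select_beats best c x : beats best x -> beats (select_step root S best c) x.
Proof.
rewrite /select_step; do 3!case: ifP => // _.
by case: best => //= b best bx; case: ifP => //= H; lia.
Qed.

Lemma select_beats_new best c : valid c -> beats (select_step root S best c) c.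
Proof.
move=> [cr cs cS _]; rewrite /select_step cr cs cS !eqxx.
by case: best => [|b best] /=; [|case: ifP => //=].
Qed.

Let e_sym : symmetric (edge G). Proof. by case: G_tree. Qed.

Lemma search_order : elim_order (edge G) root (search root m es).
Proof. by apply: search_elim_order => // -[u w]; rewrite esE. Qed.

Lemma search_all x : x \in visited root (search root m es).
Proof. by apply: (search_complete root G_tree) => [u w|]; rewrite ?esE // mE. Qed.

Lemma dp_sound B Q c : c \in dp G B Q m vs (search root m es) -> cv c = root ->
  sound G B Q m setT c.
Proof.
move=> Hc cr.
have [y||_ H] := @dp_sound_rep V G root B Q m e_sym _ id (init G m vs) search_order.
- exact: search_all.
- have -> : cluster id = (fun v : V => [set v]); last exact: init_sound.
  by apply: boolp.funext => v; apply/setP => y; rewrite !inE.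
have := H c Hc; rewrite cr; suff -> : cluster (fun _ => root) root = setT by [].
by apply/setP => y; rewrite !inE eqxx.
Qed.

Lemma mem_guesses e j : e \in es -> j < m -> j.+1 * edge_ret G e.1 e.2 \in guesses G m es.
Proof.
move=> ees jm; rewrite /guesses.
have keep (g : seq nat) x e' : x \in g -> x \in foldl (guess_step G e') g (iota 0 m).
  elim: (iota 0 m) g => //= a l IH g xg; apply: IH; by rewrite inE xg orbT.
refine (foldl_hit (P := fun g => _ \in g) _ ees _ _) => [g|g e']; last exact: keep.
refine (foldl_hit (P := fun g => _ \in g) (x := j) _ _ _ _) => [|g'|g' y].
- by rewrite mem_iota.
- exact: mem_head.
- by rewrite inE orbC => ->.
Qed.

Lemma guess0 : 0 \in guesses G m es.
Proof.
rewrite /guesses; elim: es [:: 0] (mem_head 0 [::]) => //= e l IH g g0; apply: IH.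
by elim: (iota 0 m) g g0 => //= a t IH' g g0; apply: IH'; rewrite inE g0 orbT.
Qed.

Lemma solve_valid Q b : b \in solve G root Q m S vs es -> valid b.
Proof.
move: b; rewrite /solve; refine (foldl_inv (P := fun s => forall b, b \in s -> valid b) _ _) => //.
move=> best B _ Hbest.
refine (foldl_inv (P := fun s => forall b, b \in s -> valid b) _ _) => // s c Hc Hs.
by apply: select_valid => // cr; exists B, Q; apply: dp_sound.
Qed.

Lemma solve_beats Q B c : B \in guesses G m es ->
  c \in dp G B Q m vs (search root m es) -> valid c ->
  beats (solve G root Q m S vs es) c.
Proof.
move=> Bg Hc Vc; rewrite /solve.
refine (foldl_hit (P := beats^~ c) _ Bg _ _) => [best|best B'].
  refine (foldl_hit (P := beats^~ c) _ Hc _ _) => [best'|best' y].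
    exact: select_beats_new.
  exact: select_beats.
move=> Hb; refine (foldl_inv (P := beats^~ c) _ _) => // best' y _.
exact: select_beats.
Qed.

Lemma solve_beats_opt M F : 0 < k -> feasible G S M F ->
  exists2 c, beats (solve G root (k * m) m S vs es) c &
    k * ccost c <= k.+1 * total_retrieval G M F.
Proof.
move=> k0 [MF stMF]; case: (G_tree) => V0 _ e_irr _ _.
have [par [hgt [parM parF Rpar par_hgt]]] := retrieval_forest e_irr MF.
have [N N_rec] := num_served_rec par_hgt.
have N_le v : N v <= m by rewrite mE; apply: (num_served_le par_hgt N_rec).
have N_gt0 v : 0 < N v by rewrite N_rec.
have par_edge v : par v != v -> edge G (par v) v.
  by move=> /parF; case: MF => /(_ (par v, v)) H _ /H.
set T := total_retrieval G M F.
have TE : T = \sum_(c | par c != c) N c * edge_ret G (par c) c.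
  by apply: (sum_flow N_rec) => [v /parM[]|v /Rpar].
pose B := \max_(c | par c != c) N c * edge_ret G (par c) c.
have B_ge c : par c != c -> N c * edge_ret G (par c) c <= B.
  by move=> pc; exact: (@leq_bigmax_cond V (fun c => par c != c) (fun c => N c * edge_ret G (par c) c) c pc).
have BT : B <= T.
  rewrite TE; apply/bigmax_leqP => c pc; rewrite (bigD1 c) //=; exact: leq_addr.
have Bg : B \in guesses G m es.
  (* The maximum over no edges is 0, which is why 0 is among the guesses. *)
  apply: (big_ind (fun x => x \in guesses G m es)) => [|x y xg yg|c pc].
  - exact: guess0.
  - by rewrite /maxn; case: ifP.
  - rewrite -(prednK (N_gt0 c)); apply: (@mem_guesses (par c, c)).
      by rewrite esE par_edge.
    by rewrite prednK.
have [c Hc [c1 cst_le]] := dp_complete (k * m) e_sym par_edge par_hgt N_rec N_le B_ge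
  search_order search_all vsE.
have cr : cv c = root by rewrite /cv c1.
have Sc := dp_sound Hc cr.
have Vc : valid c.
  split=> //; first by rewrite /csup /cdem c1.
    apply: leq_trans cst_le (leq_trans _ stMF); apply: forest_storage => // v /parM[] //.
  by exists B, (k * m).
exists c; first exact: solve_beats Bg Hc Vc.
case: Sc => _ [_ _ _ _ Hcost] _; move: Hcost; rewrite cardsT -mE /crho c1 /= => Hcost.
have rho_le : B * \sum_(c | par c != c) rounded G B (k * m) par N c <= k * m * T.
  rewrite TE !big_distrr /=; apply: leq_sum => v /B_ge vB.
  by have [r _ ->] := quot_spec (k * m) vB; rewrite leq_addl.
have m0 : 0 < m by rewrite mE.
have Bm : B * m <= T * m by rewrite leq_mul2r BT orbT.
(* Now [k * m * ccost c <= B * rho + B * m], where the first term is at most [k * m * T] and the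
   rounding error [B * m] at most [m * T]. *)
rewrite -(leq_pmul2l m0); move: Hcost rho_le Bm; set rho := \sum_(_ | _) _.
by clearbody rho B T; lia.
Qed.

Theorem solve_correct M F : 0 < k -> feasible G S M F ->
  exists c s, [/\ solve G root (k * m) m S vs es = c :: s,
    feasible G S [set x in cM c] [set x in cF c] &
    k * total_retrieval G [set x in cM c] [set x in cF c]
      <= k.+1 * total_retrieval G M F].
Proof.
move=> k0 /(solve_beats_opt k0)[c]; have := @solve_valid (k * m).
case: solve => //= b s /(_ b (mem_head _ _)) [_ supE stS [B [Q Sb]]] bc Hc.
have [feas tot] := sound_feasible Sb supE stS.
exists b, s; split=> //; apply: leq_trans Hc.
by rewrite leq_mul2l (leq_trans tot bc) orbT.
Qed.

End Solve.

(** * The program and its running time *)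

Local Notation v0 := (Var 0).
Local Notation v1 := (Var 1).
Local Notation v2 := (Var 2).
Local Notation nil_ := (Const 0).

Definition Ecv c := Fst (Fst c).
Definition Esup c := Fst (Snd (Fst c)).
Definition Edem c := Fst (Snd (Snd (Fst c))).
Definition Erho c := Snd (Snd (Snd (Fst c))).
Definition Est c := Fst (Snd c).
Definition Ecost c := Fst (Snd (Snd c)).
Definition EM c := Fst (Snd (Snd (Snd c))).
Definition EF c := Snd (Snd (Snd (Snd c))).

Definition Ecand v sup dem rho st cost M F :=
  Pair (Pair v (Pair sup (Pair dem rho))) (Pair st (Pair cost (Pair M F))).

(** The numbers after [Call] are positions in [prog]; a fold loops by calling its own position. *)
Definition Eiota j := Call 1 (Pair j nil_).
Definition Emul j x := Call 2 (Pair x (Pair (Eiota j) (Const 0))).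
Definition Ecatrev s t := Call 3 (Pair nil_ (Pair s t)).
Definition Eins L c := Call 7 (Pair nil_ (Pair L (Pair c nil_))).
(** The fold starts from the test whether [y] is the root, that is, vertex 0. *)
Definition Emem y o := Call 18 (Pair y (Pair o (If y (Const 0) (Const 1)))).

Definition iota_body :=
  If (Fst v0)
     (Call 1 (Pair (Defs.Sub (Fst v0) (Const 1))
        (Pair (Defs.Sub (Fst v0) (Const 1)) (Snd v0))))
     (Snd v0).

Definition mul_body := Add v0 v2.
Definition catrev_body := Pair v1 v0.

(* the context is (B, x) *)
Definition quot_body :=
  IfLe (Add (Fst v0) (Snd v2)) (Fst v2)
    (Pair (Add (Fst v0) (Snd v2)) (Snd v0))
    (Pair (Defs.Sub (Add (Fst v0) (Snd v2)) (Fst v2)) (Add (Snd v0) (Const 1))).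

(* the argument, variable 1 once j * r has been bound, is
   ((B, iota 0 Q), ((cu, cw), ((sup, dem), ((j, (s, r)), Fe)))) *)
Definition comb_body :=
  let a := v1 in
  let BQ := Fst a in let cu := Fst (Fst (Snd a)) in let cw := Snd (Fst (Snd a)) in
  let sup := Fst (Fst (Snd (Snd a))) in let dem := Snd (Fst (Snd (Snd a))) in
  let s := Fst (Snd (Fst (Snd (Snd (Snd a))))) in
  let Fe := Snd (Snd (Snd (Snd a))) in
  Let (Emul (Fst (Fst (Snd (Snd (Snd v0))))) (Snd (Snd (Fst (Snd (Snd (Snd v0)))))))
    (IfLe v0 (Fst BQ)
       (Pair
         (Pair
           (Pair (Ecv cu) (Pair sup (Pair dem (Add (Add (Erho cu) (Erho cw))
             (Snd (Call 4 (Pair (Pair (Fst BQ) v0)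
                (Pair (Snd BQ) (Pair (Const 0) (Const 0))))))))))
           (Pair (Add (Add (Est cu) (Est cw)) s)
             (Pair (Add (Add (Ecost cu) (Ecost cw)) v0)
               (Pair (Ecatrev (EM cw) (EM cu))
                 (Ecatrev Fe (Ecatrev (EF cw) (EF cu)))))))
         nil_)
       nil_).

(* the argument is ((B, iota 0 Q), (uw, (cu, cw))), where uw stands for the two
   directed edges (u, w) and (w, u) with their costs *)
Definition attach_body :=
  let BQ := Fst v0 in let e := Fst (Fst (Snd v0)) in let e' := Snd (Fst (Snd v0)) in
  let cu := Fst (Snd (Snd v0)) in let cw := Snd (Snd (Snd v0)) in
  let comb sup dem jsr Fe :=
    Call 5 (Pair BQ (Pair (Pair cu cw) (Pair (Pair sup dem) (Pair jsr Fe)))) in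
  If (Esup cw)
    (IfEq (Esup cw) (Edem cw)
      (comb (Esup cu) (Edem cu) (Pair (Const 0) (Pair (Const 0) (Const 0))) nil_)
      (IfLe (Edem cw) (Esup cw)
        (If (Esup cu) nil_
          (comb (Defs.Sub (Esup cw) (Edem cw)) (Edem cu)
             (Pair (Defs.Sub (Esup cw) (Edem cw)) (Snd e')) (Pair (Fst e') nil_)))
        nil_))
    (comb (Esup cu) (Add (Edem cu) (Edem cw)) (Pair (Edem cw) (Snd e))
       (Pair (Fst e) nil_)).

Definition ins_body :=
  let x := v1 in let b := Fst v0 in let r := Snd v0 in
  If (Add (Dist (Ecv x) (Ecv b)) (Add (Dist (Esup x) (Esup b))
        (Add (Dist (Edem x) (Edem b)) (Dist (Erho x) (Erho b)))))
     (Pair b (Pair x r))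
     (IfLe (Est x) (Est b) (Pair x r) v0).

Definition ins_all_body := Eins v0 v1.

(* the context is ((B, iota 0 Q), (uw, c1)) *)
Definition step2_body :=
  IfEq (Ecv v1) (Fst (Fst (Fst (Fst (Snd v2)))))
    (Call 8 (Pair nil_ (Pair
       (Call 6 (Pair (Fst v2) (Pair (Fst (Snd v2)) (Pair v1 (Snd (Snd v2)))))) v0)))
    v0.

(* the context is ((B, iota 0 Q), (uw, L)) *)
Definition step1_body :=
  IfEq (Ecv v1) (Snd (Fst (Fst (Fst (Snd v2)))))
    (Call 9 (Pair (Pair (Fst v2) (Pair (Fst (Snd v2)) v1))
                  (Pair (Snd (Snd v2)) v0)))
    (IfEq (Ecv v1) (Fst (Fst (Fst (Fst (Snd v2))))) v0 (Eins v0 v1)).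

Definition dp_body := Call 10 (Pair (Pair v2 (Pair v1 v0)) (Pair v0 nil_)).

Definition select_body :=
  IfEq (Ecv v1) (Const 0)
    (IfEq (Esup v1) (Edem v1)
      (IfLe (Est v1) v2
        (If v0 (IfLe (Ecost (Fst v0)) (Ecost v1) v0 (Pair v1 nil_)) (Pair v1 nil_))
        v0)
      v0)
    v0.

(* the context is ((S, iota 0 Q), (init, order)) *)
Definition solve_body :=
  Call 12 (Pair (Fst (Fst v2)) (Pair
    (Call 11 (Pair (Pair v1 (Snd (Fst v2))) (Pair (Snd (Snd v2)) (Fst (Snd v2)))))
    v0)).

Definition guess_body := Pair (Emul (Add v1 (Const 1)) v2) v0.
Definition guesses_body := Call 14 (Pair (Snd (Snd v1)) (Pair v2 v0)).

(* the context is the vertex with its storage cost *)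
Definition init_step_body :=
  Eins v0 (Ecand (Fst v2) (Add v1 (Const 1)) (Const 1) (Const 0) (Snd v2) (Const 0)
    (Pair (Fst v2) nil_) nil_).

(* the accumulator also counts the vertices *)
Definition init_body :=
  Pair (Add (Fst v0) (Const 1))
    (Call 16 (Pair (Pair (Fst v0) v1) (Pair v2
      (Eins (Snd v0) (Ecand (Fst v0) (Const 0) (Const 1) (Const 0) (Const 0)
         (Const 0) nil_ nil_))))).

Definition mem_body := IfEq (Snd (Fst (Fst v1))) v2 (Const 1) v0.

Definition lookup_body :=
  IfEq (Fst (Fst v1)) (Fst v2)
    (IfEq (Snd (Fst v1)) (Snd v2) v1 v0) v0.

(** The order stores each edge with its reverse, whose costs are looked up in the edge list, since
    [attach] may use either direction. *)
Definition visit_body :=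
  If (Emem (Fst (Fst v1)) v0)
    (If (Emem (Snd (Fst v1)) v0) v0
      (Pair (Pair v1 (Call 19 (Pair (Pair (Snd (Fst v1)) (Fst (Fst v1)))
        (Pair v2 v1)))) v0))
    v0.

Definition search_body := Call 20 (Pair v2 (Pair v2 v0)).

(** The bindings are [iota 0 n], [iota 0 (k * n)], the order, the vertex count with the initial
    candidates, the guesses, and the best candidate. The accuracy enters only as the constant
    [k]. *)
Definition main_body (k : nat) :=
  Let (Eiota (Fst v0))
  (Let (Eiota (Emul (Const k) (Fst v1)))
  (Let (Call 21 (Pair (Snd (Snd (Snd v2))) (Pair v1 nil_)))
  (Let (Call 17 (Pair v2 (Pair (Fst (Snd (Snd (Var 3)))) (Pair (Const 0) nil_))))
  (Let (Call 15 (Pair (Var 3) (Pair (Snd (Snd (Snd (Var 4)))) (Pair (Const 0) nil_))))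
  (Let (Call 13 (Pair (Pair (Pair (Fst (Snd (Var 5))) (Var 3)) (Pair (Snd v1) v2))
          (Pair v0 nil_)))
  (If v0 (Pair (EM (Fst v0)) (EF (Fst v0))) nil_)))))).

Definition prog (k : nat) : program :=
  [:: main_body k; iota_body; foldbody 2 mul_body; foldbody 3 catrev_body;
      foldbody 4 quot_body; comb_body; attach_body; foldbody 7 ins_body;
      foldbody 8 ins_all_body; foldbody 9 step2_body; foldbody 10 step1_body;
      foldbody 11 dp_body; foldbody 12 select_body; foldbody 13 solve_body;
      foldbody 14 guess_body; foldbody 15 guesses_body; foldbody 16 init_step_body;
      foldbody 17 init_body; foldbody 18 mem_body; foldbody 19 lookup_body;
      foldbody 20 visit_body; foldbody 21 search_body].

Instance enc_cand n : enc (cand 'I_n) :=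
  enc_prod (enc_prod (@enc_ord n) (enc_prod enc_nat (enc_prod enc_nat enc_nat)))
    (enc_prod enc_nat (enc_prod enc_nat
       (enc_prod (enc_seq (@enc_ord n)) (enc_seq (enc_prod (@enc_ord n) (@enc_ord n)))))).

Lemma ev_add A env e1 e2 m p b1 b2 :
  ev A env e1 (VNat m) b1 -> ev A env e2 (VNat p) b2 ->
  ev A env (Add e1 e2) (VNat (m + p)) (b1 + b2).+1.
Proof. by move=> [t Ht H] [t' Ht' H']; exists (t + t').+1; [lia|exact: EAdd]. Qed.

Ltac pure := solve [apply: ev_pure; reflexivity].

Section Execution.
Variable k : nat.
Notation ev := (ev (prog k)).

(** The constants in the [t_] bounds are generous; only polynomial growth matters. *)
Definition t_iota j := 40 * j + 20.

Lemma ev_iota j (acc : seq nat) :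
  ev [:: VPair (VNat j) (encode acc)] iota_body (encode (iota 0 j ++ acc)) (t_iota j).
Proof.
rewrite /t_iota; elim: j acc => [|j IH] acc.
  apply: ev_le; first apply: (ev_if_nat (b1 := 0)); [pure|by []|by move=> _; pure|].
  by rewrite /=; lia.
apply: ev_le; first apply: (ev_if_nat (b2 := 0)); [pure| |by []|].
  move=> _; apply: ev_call; [|reflexivity|].
    pure.
  rewrite subSS subn0.
  have -> : iota 0 j.+1 ++ acc = iota 0 j ++ j :: acc by rewrite -addn1 iotaD -catA.
  exact: (IH (j :: acc)).
by rewrite /=; lia.
Qed.

Lemma ev_Eiota env e j b : ev env e (VNat j) b ->
  ev env (Eiota e) (encode (iota 0 j)) (b + t_iota j + 10).
Proof.
move=> He; apply: ev_le.
  apply: ev_call; [|reflexivity|].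
    apply: ev_pair; [exact: He|pure].
  by rewrite -[iota 0 j]cats0; exact: (ev_iota j [::]).
by rewrite /=; lia.
Qed.

Definition t_mul j := 100 * j + 100.

(** Repeated addition takes time linear in [j], whatever the size of [x]. In every use [j] is at
    most [n] or equal to [k], so large costs in the instance do no harm. *)
Lemma ev_Emul env e1 e2 j x b1 b2 : ev env e1 (VNat j) b1 -> ev env e2 (VNat x) b2 ->
  ev env (Emul e1 e2) (VNat (j * x)) (b1 + b2 + t_mul j).
Proof.
move=> H1 H2; have -> : j * x = foldl (fun a (_ : nat) => a + x) 0 (iota 0 j).
  elim: j {H1} => // j IH; rewrite -addn1 iotaD foldl_cat -IH /=; lia.
apply: ev_le.
  apply: ev_call; [|reflexivity|].
    apply: ev_pair; [exact: H2|apply: ev_pair; [apply: ev_Eiota; exact: H1|pure]].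
  apply: (@ev_foldl _ _ _ _ nat _ nat _ (fun a _ => a + x) (fun _ => True) 0 (iota 0 j) 3 j).
  - reflexivity.
  - by rewrite size_iota.
  - by [].
  - by move=> a y arg _ _; split=> //; pure.
by rewrite /t_mul /t_iota /=; lia.
Qed.

Definition t_catrev m := 60 * m + 60.

Lemma ev_Ecatrev env e1 e2 (T : eqType) (eT : enc T) (l1 l2 : seq T) m b1 b2 :
  size l1 <= m -> ev env e1 (encode l1) b1 -> ev env e2 (encode l2) b2 ->
  ev env (Ecatrev e1 e2) (encode (catrev l1 l2)) (b1 + b2 + t_catrev m).
Proof.
move=> Hm H1 H2; have -> : catrev l1 l2 = foldl (fun a x => x :: a) l2 l1.
  by elim: l1 l2 {Hm H1 H2} => //= x l1 IH l2; rewrite IH.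
apply: ev_le.
  apply: ev_call; [|reflexivity|].
    by apply: ev_pair; [pure|apply: ev_pair; [exact: H1|exact: H2]].
  apply: (@ev_foldl _ _ _ _ (seq T) _ T eT (fun a x => x :: a) (fun _ => True) l2 l1 3 m) => //.
  by move=> a y arg _ _; split=> //; pure.
by rewrite /t_catrev /=; lia.
Qed.

Definition t_quot Q := 100 * Q + 100.

Lemma ev_quot env e B Q x b :
  ev env e (VPair (VPair (VNat B) (VNat x))
    (VPair (encode (iota 0 Q)) (VPair (VNat 0) (VNat 0)))) b ->
  ev env (Snd (Call 4 e)) (VNat (quot B Q x)) (b + t_quot Q).
Proof.
move=> He; apply: ev_le.
  apply: (@ev_snd _ _ _ (VNat (foldl (quot_step B x) (0, 0) (iota 0 Q)).1)).
  apply: ev_call; [exact: He|reflexivity|].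
  apply: (@ev_foldl _ _ _ _ (nat * nat) _ nat _ (quot_step B x) (fun _ => True)
    (0, 0) (iota 0 Q) 50 Q) => //.
    by rewrite size_iota.
  move=> [rem cnt] y arg _ _; split=> //; rewrite /quot_step /=.
  apply: ev_le; first apply: ev_if_le.
  - reflexivity.
  - reflexivity.
  - by move=> ->; pure.
  - by move=> /negPf->; rewrite -[cnt.+1]addn1; pure.
  - by rewrite /=; lia.
by rewrite /t_quot; lia.
Qed.

Variable n : nat.
Implicit Types (cu cw c : cand 'I_n) (L : seq (cand 'I_n)).

Definition t_comb Q := t_mul n + t_quot Q + 3 * t_catrev n.+1 + 1000.

Lemma ev_comb B Q cu cw sup dem j s r (Fe : seq ('I_n * 'I_n)) :
  size (cM cw) <= n -> size (cF cw) <= n -> size Fe <= 1 -> j <= n ->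
  ev [:: VPair (VPair (VNat B) (encode (iota 0 Q)))
      (VPair (VPair (encode cu) (encode cw))
        (VPair (VPair (VNat sup) (VNat dem))
          (VPair (VPair (VNat j) (VPair (VNat s) (VNat r))) (encode Fe))))]
    comb_body (encode (comb B Q cu cw sup dem j s r Fe)) (t_comb Q).
Proof.
move=> sM sF sFe jn; rewrite /comb_body; apply: ev_le.
  apply: ev_let; first by apply: ev_Emul; pure.
  apply: ev_if_le; [reflexivity|reflexivity| |].
    move=> jr; rewrite /comb jr.
    apply: ev_pair; [apply: ev_pair|pure].
      apply: ev_pair; first pure.
      apply: ev_pair; first pure.
      apply: ev_pair; first pure.
      apply: ev_add; first pure.
      by apply: ev_quot; pure.
    apply: ev_pair; first pure.
    apply: ev_pair; first pure.
    apply: ev_pair; first by apply: (ev_Ecatrev (m := n)) => //; pure.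
    apply: (ev_Ecatrev (m := 1)) => //; first pure.
    by apply: (ev_Ecatrev (m := n)) => //; pure.
  by move=> /negPf jr; rewrite /comb jr; pure.
by rewrite /t_comb /t_mul /t_quot /t_catrev /=; lia.
Qed.

Variable G : version_graph 'I_n.

Definition enc_cost_edge (e : 'I_n * 'I_n) : value :=
  VPair (enc_edge e) (VPair (VNat (edge_store G e.1 e.2)) (VNat (edge_ret G e.1 e.2))).
Definition enc_entry (e : 'I_n * 'I_n) : value :=
  VPair (enc_cost_edge e) (enc_cost_edge (e.2, e.1)).

Definition t_attach Q := 3 * t_comb Q + 1000.

Lemma ev_attach B Q u w cu cw :
  size (cM cw) <= n -> size (cF cw) <= n -> csup cw <= n -> cdem cw <= n ->
  ev [:: VPair (VPair (VNat B) (encode (iota 0 Q)))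
      (VPair (enc_entry (u, w)) (VPair (encode cu) (encode cw)))]
    attach_body (encode (attach G B Q u w cu cw)) (t_attach Q).
Proof.
move=> sM sF sn dn; rewrite /attach_body /attach; apply: ev_le.
  apply: (ev_if_nat (m := csup cw)); first pure.
    rewrite lt0n => /negPf->.
    apply: ev_if_eq; [reflexivity|reflexivity| |].
      rewrite -[cw.1.2.1]/(csup cw) => ->; rewrite eqxx; apply: ev_call; [pure|reflexivity|].
      exact: (@ev_comb B Q cu cw (csup cu) (cdem cu) 0 0 0 [::]).
    move=> /negPf->; apply: ev_if_le; [reflexivity|reflexivity| |].
      move=> ->; apply: (ev_if_nat (m := csup cu)); first pure.
        by rewrite lt0n => /negPf->; pure.
      move=> ->; rewrite eqxx; apply: ev_call; [pure|reflexivity|].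
      apply: (@ev_comb B Q cu cw (csup cw - cdem cw) (cdem cu) (csup cw - cdem cw)
        (edge_store G w u) (edge_ret G w u) [:: (w, u)]) => //.
      exact: leq_trans (leq_subr _ _) sn.
    by move=> /negPf->; pure.
  move=> ->; rewrite eqxx; apply: ev_call; [pure|reflexivity|].
  exact: (@ev_comb B Q cu cw (csup cu) (cdem cu + cdem cw) (cdem cw)
    (edge_store G u w) (edge_ret G u w) [:: (u, w)]).
by rewrite /t_attach /=; lia.
Qed.

Definition t_ins s := 1000 * s + 1000.

Lemma ev_Eins env e1 e2 L c s b1 b2 : size L <= s ->
  ev env e1 (encode L) b1 -> ev env e2 (encode c) b2 ->
  ev env (Eins e1 e2) (encode (ins L c)) (b1 + b2 + t_ins s).
Proof.
move=> Hs H1 H2; apply: ev_le.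
  apply: ev_call; [|reflexivity|].
    apply: ev_pair; [pure|apply: ev_pair; [exact: H1|apply: ev_pair; [exact: H2|pure]]].
  apply: (@ev_foldl _ _ _ _ (cand 'I_n * seq (cand 'I_n)) _ (cand 'I_n) _
    (@ins_step 'I_n) (fun _ => True) (c, [::]) L 900 s) => //.
  move=> [b r] x arg _ _; split=> //; rewrite /ins_step /=; apply: ev_le.
    apply: ev_if_nat; first pure.
      case: eqP => [-> |_ _]; last by pure.
      by rewrite /= !subnn.
    move=> H; have -> : x.1 == b.1.
      move: H; rewrite /cv /csup /cdem /crho.
      case: x.1 b.1 => [x1 [x2 [x3 x4]]] [y1 [y2 [y3 y4]]] /= H.
      by rewrite !xpair_eqE -val_eqE /=; lia.
    apply: ev_if_le; [reflexivity|reflexivity| |].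
      by move=> ->; pure.
    by move=> /negPf->; pure.
  by rewrite /=; lia.
by rewrite /t_ins /=; lia.
Qed.

Hypothesis G_tree : bidirectional_tree G.
Let G_sym : symmetric (edge G). Proof. by case: G_tree. Qed.
Let G_irr : irreflexive (edge G). Proof. by case: G_tree. Qed.

Definition num_keys Q := n * (n.+1 * (n.+1 * (Q * n).+1)).

Lemma size_sound B Q Cl L : all_sound G B Q n Cl L -> size L <= num_keys Q.
Proof. by move=> /size_all_sound; rewrite card_ord. Qed.

Lemma small_sound B Q Cl L c : all_sound G B Q n Cl L -> c \in L ->
  [/\ csup c <= n, cdem c <= n, size (cM c) <= n & size (cF c) <= n].
Proof. by move=> HL /(all_sound_small HL); rewrite card_ord. Qed.

Definition t_ins_all Q := t_ins (num_keys Q) + 500.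

Lemma ev_ins_all env e1 e2 B Q Cl s L b1 b2 : size s <= 1 ->
  all_sound G B Q n Cl L -> (forall c, c \in s -> sound G B Q n (Cl (cv c)) c) ->
  ev env e1 (encode s) b1 -> ev env e2 (encode L) b2 ->
  ev env (Call 8 (Pair nil_ (Pair e1 e2))) (encode (foldl (@ins 'I_n) L s))
    (b1 + b2 + t_ins_all Q).
Proof.
move=> s1 HL Hs H1 H2; apply: ev_le.
  apply: ev_call; [|reflexivity|].
    apply: ev_pair; [pure|apply: ev_pair; [exact: H1|exact: H2]].
  apply: (@ev_foldl _ _ _ _ (seq (cand 'I_n)) _ (cand 'I_n) _ (@ins 'I_n)
    (all_sound G B Q n Cl) L s (t_ins (num_keys Q) + 2) 1) => //.
  move=> a c arg Ha /Hs Hc; split; first exact: all_sound_ins.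
  apply: ev_le; first by apply: (ev_Eins (size_sound Ha)); pure.
  by rewrite /=; lia.
by rewrite /t_ins_all /=; lia.
Qed.

Lemma size_attach B Q u w cu cw : size (attach G B Q u w cu cw) <= 1.
Proof. by rewrite /attach /comb; do ?case: ifP. Qed.

Definition t_step2 Q := (t_attach Q + t_ins_all Q + 200) * num_keys Q + 100.
Definition t_step1 Q := (t_step2 Q + t_ins (num_keys Q) + 300) * num_keys Q + 100.

Section Step.
Variables (B Q : nat) (rep : 'I_n -> 'I_n) (L : seq (cand 'I_n)) (u w : 'I_n).
Hypotheses (euw : edge G u w) (L_sound : all_sound G B Q n (cluster rep) L).
Notation Cl := (cluster (join_rep rep (u, w))).
Notation BQ := (VPair (VNat B) (encode (iota 0 Q))).

Let uw : u != w.
Proof. by apply/eqP => E; move: euw; rewrite E G_irr. Qed.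

Lemma ev_step2 c1 acc : c1 \in L -> cv c1 = w -> all_sound G B Q n Cl acc ->
  ev [:: VPair (VPair BQ (VPair (enc_entry (u, w)) (encode c1)))
        (VPair (encode L) (encode acc))]
    (foldbody 9 step2_body) (encode (foldl (step2 G B Q (u, w) c1) acc L)) (t_step2 Q).
Proof.
move=> L1 c1w Hacc; apply: ev_le.
  apply: (@ev_foldl _ _ _ _ (seq (cand 'I_n)) _ (cand 'I_n) _ _
    (all_sound G B Q n Cl) acc L (t_attach Q + t_ins_all Q + 100) (num_keys Q)) => //.
    exact: size_sound L_sound.
  move=> a c2 arg Ha L2; split; first exact: (step2_sound G_sym uw euw L_sound).
  apply: ev_le.
    apply: (ev_if_eq (m := cv c2) (p := u)); [reflexivity|reflexivity| |].
      move=> /val_inj c2u; rewrite /step2 /= c2u eqxx.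
      apply: (@ev_ins_all _ _ _ B Q Cl); [exact: size_attach|exact: Ha| | |pure].
        exact: (offers2_sound G_sym uw euw L_sound).
      apply: ev_call; [pure|reflexivity|].
      by have [? ? ? ?] := small_sound L_sound L1; apply: ev_attach.
    move=> c2u; rewrite /step2 /=.
    have /negPf-> : cv c2 != u by rewrite -val_eqE.
    by pure.
  by rewrite /=; lia.
by rewrite /t_step2; lia.
Qed.

Lemma ev_step1 :
  ev [:: VPair (VPair BQ (VPair (enc_entry (u, w)) (encode L)))
        (VPair (encode L) (VNat 0))]
    (foldbody 10 step1_body) (encode (step G B Q L (u, w))) (t_step1 Q).
Proof.
apply: ev_le.
  apply: (@ev_foldl _ _ _ _ (seq (cand 'I_n)) _ (cand 'I_n) _ _
    (all_sound G B Q n Cl) [::] L (t_step2 Q + t_ins (num_keys Q) + 200) (num_keys Q)) => //.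
    exact: size_sound L_sound.
  move=> a c1 arg Ha L1; split; first exact: (step1_sound G_sym uw euw L_sound).
  apply: ev_le.
    apply: (ev_if_eq (m := cv c1) (p := w)); [reflexivity|reflexivity| |].
      move=> /val_inj c1w; rewrite /step1 /= c1w eqxx.
      by apply: ev_call; [pure|reflexivity|apply: ev_step2].
    move=> c1w; rewrite /step1 /=.
    have /negPf-> : cv c1 != w by exact: c1w.
    apply: (ev_if_eq (m := cv c1) (p := u)); [reflexivity|reflexivity| |].
      by move=> /val_inj->; rewrite eqxx; pure.
    move=> c1u; have /negPf-> : cv c1 != u by exact: c1u.
    by apply: (ev_Eins (size_sound Ha)); pure.
  by rewrite /=; lia.
by rewrite /t_step1; lia.
Qed.

End Step.

Definition t_dp Q := (t_step1 Q + 100) * n + 100.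

Lemma ev_dp B Q L o : size o <= n -> (exists rep, all_sound G B Q n (cluster rep) L) ->
  {in o, forall uw, edge G uw.1 uw.2} ->
  ev [:: VPair (VPair (VNat B) (encode (iota 0 Q)))
        (VPair (enc_list (map enc_entry o)) (encode L))]
    (foldbody 11 dp_body) (encode (foldl (step G B Q) L o)) (t_dp Q) /\
  exists rep, all_sound G B Q n (cluster rep) (foldl (step G B Q) L o).
Proof.
move=> on HL Ho; split; last first.
  refine (foldl_inv (P := fun L => exists rep, all_sound G B Q n (cluster rep) L) HL _).
  move=> L' [u w] /Ho /= euw [rep HL']; exists (join_rep rep (u, w)).
  by apply: (step_sound G_sym) => //; apply/eqP => E; move: euw; rewrite E G_irr.
apply: ev_le.
  apply: (@ev_foldl _ _ _ _ (seq (cand 'I_n)) _ ('I_n * 'I_n)%type enc_entry _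
    (fun L => exists rep, all_sound G B Q n (cluster rep) L) L o (t_step1 Q + 50) n) => //.
  move=> L' [u w] arg [rep HL'] /Ho /= euw; split.
    exists (join_rep rep (u, w)).
    by apply: (step_sound G_sym) => //; apply/eqP => E; move: euw; rewrite E G_irr.
  apply: ev_le.
    by apply: ev_call; [pure|reflexivity|apply: (ev_step1 euw HL')].
  by rewrite /=; lia.
by rewrite /t_dp; lia.
Qed.

Notation Iv := (encode (iota 0 n)).

Lemma size_foldl_cons (T U : Type) (f : seq T -> U -> T) (l : seq U) acc :
  size (foldl (fun a x => f a x :: a) acc l) = size l + size acc.
Proof. by elim: l acc => //= x l IH acc; rewrite IH /= addnS. Qed.

Lemma size_guesses es acc :
  size (foldl (fun acc e => foldl (guess_step G e) acc (iota 0 n)) acc es) =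
  size es * n + size acc.
Proof.
elim: es acc => //= e es IH acc; rewrite IH /guess_step.
by rewrite (size_foldl_cons (fun _ j => j.+1 * _)) size_iota mulSn addnCA addnA.
Qed.

Definition t_guesses := (t_mul n * n + 500 * n + 500) * (n * n) + 100.

Lemma ev_guesses es : size es <= n * n ->
  ev [:: VPair Iv (VPair (enc_list (map enc_cost_edge es)) (VPair (VNat 0) (VNat 0)))]
    (foldbody 15 guesses_body) (encode (guesses G n es)) t_guesses.
Proof.
move=> Hes; apply: ev_le.
  apply: (@ev_foldl _ _ _ _ (seq nat) _ ('I_n * 'I_n)%type enc_cost_edge _
    (fun _ => True) [:: 0] es (t_mul n * n + 400 * n + 200) (n * n)) => //.
  move=> a e arg _ _; split=> //; apply: ev_le.
    apply: ev_call; [pure|reflexivity|].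
    apply: (@ev_foldl _ _ _ _ (seq nat) _ nat _ (guess_step G e)
      (fun _ => True) a (iota 0 n) (t_mul n + 50) n) => //.
      by rewrite size_iota.
    move=> acc j arg' _; rewrite mem_iota add0n => /andP[_ jn]; split=> //.
    rewrite /guess_step -addn1; apply: ev_le.
      by apply: ev_pair; [apply: ev_Emul; pure|pure].
    by rewrite /t_mul /=; lia.
  by rewrite /=; lia.
by rewrite /t_guesses; lia.
Qed.

Definition t_init := (t_ins (num_keys 0) * n + 1000 * n + t_ins (num_keys 0) + 1000) * n + 100.

Lemma ev_init :
  ev [:: VPair Iv (VPair (enc_list [seq VNat (vertex_store G v) | v <- enum 'I_n])
       (VPair (VNat 0) (VNat 0)))]
    (foldbody 17 init_body) (VPair (VNat n) (encode (init G n (enum 'I_n)))) t_init.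
Proof.
(* The instance lists vertex costs without names, so the position supplies the vertex. *)
pose acc j := VPair (VNat j) (@encode _ (@enc_seq _ (@enc_cand n)) (foldl (init_vertex G n) [::] (take j (enum 'I_n)))).
have Hsize : size [seq VNat (vertex_store G v) | v <- enum 'I_n] = n.
  by rewrite size_map size_enum_ord.
have E : VPair (VNat n) (encode (init G n (enum 'I_n))) =
    acc (size [seq VNat (vertex_store G v) | v <- enum 'I_n]).
  by rewrite Hsize /acc take_oversize // size_enum_ord.
have E0 : acc 0 = VPair (VNat 0) (VNat 0) by rewrite /acc take0.
rewrite E -E0; apply: ev_le.
  apply: (@ev_fold _ _ _ _ _ acc (t_ins (num_keys 0) * n + 800 * n + t_ins (num_keys 0) + 800) n) => //.
    by rewrite Hsize.
  move=> j arg; rewrite Hsize => jn; pose v := Ordinal jn.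
  have Hv : nth v (enum 'I_n) j = v by apply: val_inj; rewrite /= nth_enum_ord.
  rewrite (nth_map v) ?size_enum_ord // Hv.
  (* Initial candidates have rounded cost 0 and are sound even for [B = Q = 0], which bounds their
     number independently of [Q]. *)
  have : all_sound G 0 0 n (fun x => [set x]) (foldl (init_vertex G n) [::] (take j (enum 'I_n))).
    exact: init_sound.
  rewrite /acc (take_nth v) ?size_enum_ord // foldl_rcons Hv.
  move: (foldl _ _ _) => L HL; rewrite -[j.+1]addn1; apply: ev_le.
    apply: ev_pair; first pure.
    apply: ev_call; [|reflexivity|].
      apply: ev_pair; first pure.
      apply: ev_pair; first pure.
      by apply: (@ev_Eins _ _ _ L ((v, (0, (1, 0))), (0, (0, ([::], [::])))) _ _ _
        (size_sound HL)); pure.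
    apply: (@ev_foldl _ _ _ _ (seq (cand 'I_n)) _ nat _ (init_step G v)
      (all_sound G 0 0 n (fun x => [set x])) _ (iota 0 n) (t_ins (num_keys 0) + 200) n) => //.
    + by rewrite size_iota.
    + exact: init_start_sound.
    move=> a x arg' Ha; rewrite mem_iota add0n => /andP[_ xn]; split.
      exact: init_step_sound.
    apply: ev_le.
      rewrite /init_step; apply: (ev_Eins (size_sound Ha)); first pure.
      by rewrite -[x.+1]addn1; pure.
    by rewrite /=; lia.
  by rewrite /t_ins /=; lia.
by rewrite /t_init; lia.
Qed.

Variable root : 'I_n.
Hypothesis root0 : root = 0 :> nat.

Definition t_select Q := 1000 * num_keys Q + 100.

Lemma ev_select S best L Q : size L <= num_keys Q ->
  ev [:: VPair (VNat S) (VPair (encode L) (encode best))]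
    (foldbody 12 select_body) (encode (foldl (select_step root S) best L)) (t_select Q).
Proof.
move=> HL; apply: ev_le.
  apply: (@ev_foldl _ _ _ _ (seq (cand 'I_n)) _ (cand 'I_n) _ _
    (fun _ => True) best L 900 (num_keys Q)) => //.
  move=> a c arg _ _; split=> //; apply: ev_le.
    apply: (ev_if_eq (m := cv c) (p := root)); [reflexivity|by rewrite root0| |]; rewrite /select_step.
      move=> /val_inj->; rewrite eqxx.
      apply: (ev_if_eq (m := csup c) (p := cdem c)); [reflexivity|reflexivity| |].
        move=> ->; rewrite eqxx.
        apply: (ev_if_le (m := cst c)); [reflexivity|reflexivity| |].
          move=> ->; apply: (ev_if (w := encode a)); first pure.
            case: a => // b a _; apply: (ev_if_le (m := ccost b) (p := ccost c));
              [reflexivity|reflexivity| |].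
              by move=> ->; pure.
            by move=> /negPf->; pure.
          by case: a => // _; pure.
        by move=> /negPf->; pure.
      by move=> /negPf->; pure.
    move=> cr; have /negPf-> : cv c != root by apply: contra_neq cr => ->.
    by pure.
  by rewrite /=; lia.
by rewrite /t_select; lia.
Qed.

Definition num_guesses := (n * n * n).+1.
Definition t_solve Q := (t_dp Q + t_select Q + 300) * num_guesses + 100.

Lemma ev_solve S Q Bs L o : size Bs <= num_guesses -> size o <= n ->
  (forall B, exists rep, all_sound G B Q n (cluster rep) L) ->
  {in o, forall uw, edge G uw.1 uw.2} ->
  ev [:: VPair (VPair (VPair (VNat S) (encode (iota 0 Q)))
                  (VPair (encode L) (enc_list (map enc_entry o))))
        (VPair (encode Bs) (VNat 0))]
    (foldbody 13 solve_body)
    (encode (foldl (fun best B => foldl (select_step root S) best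
       (foldl (step G B Q) L o)) [::] Bs)) (t_solve Q).
Proof.
move=> HB on HL Ho; apply: ev_le.
  apply: (@ev_foldl _ _ _ _ (seq (cand 'I_n)) _ nat _ _
    (fun _ => True) [::] Bs (t_dp Q + t_select Q + 200) num_guesses) => //.
  move=> a B arg _ _; split=> //.
  have [Hdp [rep Hrep]] := ev_dp on (HL B) Ho.
  apply: ev_le.
    apply: ev_call; [|reflexivity|exact: (ev_select S a (size_sound Hrep))].
    apply: ev_pair; first pure.
    apply: ev_pair; last pure.
    by apply: ev_call; [pure|reflexivity|exact: Hdp].
  by rewrite /=; lia.
by rewrite /t_solve; lia.
Qed.

Definition t_mem := 300 * n + 100.

Lemma ev_Emem env e1 e2 (y : 'I_n) o b : size o <= n -> peval env e1 = Some (VNat y) ->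
  ev env e2 (enc_list (map enc_entry o)) b ->
  ev env (Emem e1 e2) (encode (y \in visited root o)) (b + 2 * esize e1 + t_mem).
Proof.
move=> on H1 H2.
have yroot : (y == root) = (nat_of_ord y == 0) by rewrite -[X in nat_of_ord y == X]root0.
have -> : (y \in visited root o) =
    foldl (fun (b : bool) e => if e.2 == y then true else b) (y == root) o.
  rewrite inE; elim: o (y == root) {on H2} => [|e o IH] r /=; first by rewrite orbF.
  by rewrite -IH in_cons [y == _]eq_sym; case: (e.2 == y); rewrite ?orbT.
apply: ev_le.
  apply: ev_call; [|reflexivity|].
    apply: ev_pair; first by apply: ev_pure; exact: H1.
    apply: ev_pair; first exact: H2.
    apply: (ev_if_nat (m := y) (v := encode (y == root))); first by apply: ev_pure.
      by rewrite yroot lt0n => /negPf->; pure.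
    by rewrite yroot => ->; pure.
  apply: (@ev_foldl _ _ _ _ bool _ ('I_n * 'I_n)%type enc_entry _
    (fun _ => True) (y == root) o 100 n) => //.
  move=> a e arg _ _; split=> //; apply: ev_le.
    apply: (ev_if_eq (m := e.2) (p := y)); [reflexivity|reflexivity| |].
      by move=> /val_inj->; rewrite eqxx; pure.
    move=> ey; have /negPf-> : e.2 != y by exact: ey.
    by pure.
  by rewrite /=; lia.
by rewrite /t_mem /=; lia.
Qed.

Definition t_lookup := 200 * (n * n) + 100.

(** The initial value [(u, w)] is a placeholder, overwritten because the reverse edge is in the
    list. *)
Lemma ev_lookup (es : seq ('I_n * 'I_n)) (u w : 'I_n) :
  size es <= n * n -> (w, u) \in es ->
  ev [:: VPair (VPair (VNat w) (VNat u)) (VPair (enc_list (map enc_cost_edge es))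
          (enc_cost_edge (u, w)))]
    (foldbody 19 lookup_body) (enc_cost_edge (w, u)) t_lookup.
Proof.
move=> Hes Hwu.
pose f (r e : 'I_n * 'I_n) := if e.1 == w then if e.2 == u then e else r else r.
have fE r e : f r e = if e == (w, u) then (w, u) else r.
  rewrite /f; case: e => a b /=; rewrite xpair_eqE.
  by case: (eqVneq a w) => //= ->; case: eqP => // ->.
have E : foldl f (u, w) es = (w, u).
  refine (foldl_hit (P := fun r => r = (w, u)) _ Hwu _ _) => [r|r e Hr].
    by rewrite fE eqxx.
  by rewrite fE Hr; case: ifP.
apply: ev_le.
  rewrite -E; apply: (@ev_foldl _ _ _ _ ('I_n * 'I_n)%type enc_cost_edge
    ('I_n * 'I_n)%type enc_cost_edge f (fun _ => True) (u, w) es 100 (n * n)) => //.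
  move=> a e arg _ _; split=> //; rewrite /f; apply: ev_le.
    apply: (ev_if_eq (m := e.1) (p := w)); [reflexivity|reflexivity| |].
      move=> /val_inj->; rewrite eqxx.
      apply: (ev_if_eq (m := e.2) (p := u)); [reflexivity|reflexivity| |].
        by move=> /val_inj->; rewrite eqxx; pure.
      move=> eu; have /negPf-> : e.2 != u by exact: eu.
      by pure.
    move=> ew; have /negPf-> : e.1 != w by exact: ew.
    by pure.
  by rewrite /=; lia.
by rewrite /t_lookup; lia.
Qed.

Definition t_search := ((2 * t_mem + t_lookup + 500) * (n * n) + 500) * n + 100.

Lemma ev_search (es : seq ('I_n * 'I_n)) : size es <= n * n ->
  (forall u w, ((u, w) \in es) = edge G u w) ->
  ev [:: VPair (enc_list (map enc_cost_edge es)) (VPair Iv (VNat 0))]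
    (foldbody 21 search_body) (enc_list (map enc_entry (search root n es))) t_search.
Proof.
move=> Hes esE.
have esP : {in es, forall uw, edge G uw.1 uw.2} by case=> u w; rewrite esE.
apply: ev_le.
  apply: (@ev_foldl _ _ _ _ (seq ('I_n * 'I_n)) (@enc_seq _ enc_entry) nat _ _
    (elim_order (edge G) root) [::] (iota 0 n) ((2 * t_mem + t_lookup + 500) * (n * n) + 300) n) => //.
    by rewrite size_iota.
  move=> o i arg Ho _; split; first exact: (visit_foldl_elim_order G_tree).
  apply: ev_le.
    apply: ev_call; [pure|reflexivity|].
    apply: (@ev_foldl _ _ _ _ (seq ('I_n * 'I_n)) (@enc_seq _ enc_entry) ('I_n * 'I_n)%type
      enc_cost_edge _ (elim_order (edge G) root) o es (2 * t_mem + t_lookup + 400) (n * n)) => //.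
    move=> {Ho}o [u w] arg' Ho uw_es; split.
      by apply: (visit_elim_order G_tree) => //; apply: esP.
    have on : size o <= n by rewrite -[n in _ <= n]card_ord ltnW // (size_elim_order Ho).
    rewrite /visit /=; apply: ev_le.
      apply: (ev_if_nat (m := (u \in visited root o))).
      - by apply: (ev_Emem (y := u) on); [reflexivity|pure].
      - rewrite lt0b => ->; apply: (ev_if_nat (m := (w \in visited root o))).
        + by apply: (ev_Emem (y := w) on); [reflexivity|pure].
        + by rewrite lt0b => ->; pure.
        + move/eqP; rewrite eqb0 => /negPf->; apply: ev_pair; last pure.
          apply: ev_pair; first pure.
          apply: ev_call; [pure|reflexivity|apply: ev_lookup => //].
          by rewrite esE G_sym -esE.
      - by move/eqP; rewrite eqb0 => /negPf->; pure.
    by rewrite /=; lia.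
  by rewrite /=; lia.
by rewrite /t_search; lia.
Qed.

End Execution.

Section Main.
Variables (k n : nat) (G : version_graph 'I_n) (S : nat) (root : 'I_n).
Hypothesis root0 : root = 0 :> nat.
Hypothesis G_tree : bidirectional_tree G.

Lemma mem_edge_list u w : ((u, w) \in edge_list G) = edge G u w.
Proof.
rewrite mem_filter /=; apply/andP/idP => [[]//|uw]; split=> //.
by apply: allpairs_f; rewrite mem_enum.
Qed.

Lemma size_edge_list : size (edge_list G) <= n * n.
Proof.
by rewrite size_filter (leq_trans (count_size _ _)) // size_allpairs size_enum_ord.
Qed.

Lemma elim_order_edge o : elim_order (edge G) root o ->
  {in o, forall uw, edge G uw.1 uw.2}.
Proof.
elim: o => [//|[u w] o IH] /= [_ _ euw _ /IH Ho] e.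
by rewrite inE => /orP[/eqP->//|]; apply: Ho.
Qed.

Definition fptas_result : value :=
  if solve G root (k * n) n S (enum 'I_n) (edge_list G) is c :: _
  then VPair (encode (cM c)) (encode (cF c)) else VNat 0.

Definition t_main : nat :=
  t_iota n + t_iota k + t_mul k + t_iota (k * n) + t_search n + t_init n +
  t_guesses n + t_solve n (k * n) + 1000.

Lemma ev_main : ev (prog k) [:: enc_instance G S] (main_body k) fptas_result t_main.
Proof.
have Ho := search_order root n G_tree mem_edge_list.
have on : size (search root n (edge_list G)) <= n.
  by rewrite -[n in _ <= n]card_ord ltnW // (size_elim_order Ho).
rewrite /main_body; apply: ev_le.
  apply: ev_let; first by apply: ev_Eiota; pure.
  apply: ev_let; first by apply: ev_Eiota; apply: ev_Emul; pure.
  apply: ev_let.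
    apply: ev_call; [pure|reflexivity|].
    exact: (ev_search k G_tree root0 size_edge_list mem_edge_list).
  apply: ev_let.
    by apply: ev_call; [pure|reflexivity|exact: ev_init].
  apply: ev_let.
    by apply: ev_call; [pure|reflexivity|exact: (ev_guesses k G size_edge_list)].
  apply: ev_let.
    apply: ev_call; [|reflexivity|].
      pure.
    apply: (ev_solve k G_tree root0 S (Q := k * n) (Bs := guesses G n (edge_list G))
      (L := init G n (enum 'I_n)) (o := search root n (edge_list G))) => //.
    - rewrite /guesses size_guesses addn1 ltnS leq_mul2r size_edge_list; lia.
    - move=> B; exists id.
      have -> : cluster id = (fun v : 'I_n => [set v]); last exact: init_sound.
      by apply/boolp.funext => v; apply/setP => y; rewrite !inE.
    - exact: elim_order_edge.
  rewrite -/(solve G root (k * n) n S (enum 'I_n) (edge_list G)) /fptas_result.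
  case: solve => [|c s].
    by apply: (ev_if (w := VNat 0)); [pure| |move=> _; pure].
  apply: ev_if; first pure.
    by move=> _; pure.
  by [].
by rewrite /t_main /=; lia.
Qed.

End Main.

(** * Polynomial bounds in two variables *)

Definition poly_bounded (f : nat -> nat -> nat) : Prop :=
  exists C d, forall n k, f n k <= C * (n + k).+1 ^ d.

Lemma poly_bounded_const c : poly_bounded (fun _ _ => c).
Proof. by exists c, 0 => n k; rewrite muln1. Qed.

Lemma poly_bounded_n : poly_bounded (fun n _ => n).
Proof. by exists 1, 1 => n k; rewrite mul1n expn1; lia. Qed.

Lemma poly_bounded_k : poly_bounded (fun _ k => k).
Proof. by exists 1, 1 => n k; rewrite mul1n expn1; lia. Qed.

(** The base [(n + k).+1] is at least 1, so both bounds can be raised to the larger exponent. *)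
Lemma poly_boundedD f g : poly_bounded f -> poly_bounded g ->
  poly_bounded (fun n k => f n k + g n k).
Proof.
move=> [C [d Hf]] [C' [d' Hg]]; exists (C + C'), (maxn d d') => n k.
rewrite mulnDl; apply: leq_add.
  by apply: leq_trans (Hf n k) _; rewrite leq_mul2l leq_pexp2l ?leq_maxl ?orbT.
by apply: leq_trans (Hg n k) _; rewrite leq_mul2l leq_pexp2l ?leq_maxr ?orbT.
Qed.

Lemma poly_boundedM f g : poly_bounded f -> poly_bounded g ->
  poly_bounded (fun n k => f n k * g n k).
Proof.
move=> [C [d Hf]] [C' [d' Hg]]; exists (C * C'), (d + d') => n k.
by rewrite expnD mulnACA; apply: leq_mul.
Qed.

Lemma poly_boundedS f : poly_bounded f -> poly_bounded (fun n k => (f n k).+1).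
Proof.
move=> Hf; have [C [d H]] := poly_boundedD (poly_bounded_const 1) Hf.
by exists C, d => n k; apply: H.
Qed.

Ltac poly_bound := lazymatch goal with
  | |- poly_bounded (fun _ _ => ?c) => exact: (poly_bounded_const c)
  | |- poly_bounded (fun n _ => n) => exact: poly_bounded_n
  | |- poly_bounded (fun _ k => k) => exact: poly_bounded_k
  | |- poly_bounded (fun n k => addn (@?f n k) (@?g n k)) =>
      apply: (@poly_boundedD f g); poly_bound
  | |- poly_bounded (fun n k => muln (@?f n k) (@?g n k)) =>
      apply: (@poly_boundedM f g); poly_bound
  | |- poly_bounded (fun n k => S (@?f n k)) =>
      apply: (@poly_boundedS f); poly_bound
  end.

Lemma t_main_poly : poly_bounded (fun n k => t_main k n).
Proof.
rewrite /t_main /t_solve /t_dp /t_select /num_guesses /t_search /t_init /t_guesses.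
rewrite /t_step1 /t_step2 /t_ins_all /t_attach /t_comb /t_mem /t_lookup /num_keys.
rewrite /t_ins /t_iota /t_mul /t_quot /t_catrev.
by poly_bound.
Qed.

Import Order.TTheory GRing.Theory Num.Theory.
Local Open Scope ring_scope.

Lemma fptas_result_approximates (R : realType) (eps : R) k n (G : version_graph 'I_n) S
    (root : 'I_n) : (0 < k)%N -> 1 <= k%:R * eps -> bidirectional_tree G ->
  approximates eps G S (fptas_result k G S root).
Proof.
move=> k0 keps G_tree [M0 [F0 feas0]].
have H M F (feas : feasible G S M F) := solve_correct root G_tree (esym (card_ord n))
  (fun v => mem_enum 'I_n v) (mem_edge_list G) k0 feas.
have [c [s [E feas _]]] := H _ _ feas0.
rewrite /fptas_result E; exists [set x in cM c], [set x in cF c]; split=> //.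
  by exists (cM c), (cF c); split=> // x; rewrite inE.
move=> M F /H[c' [s' [E' _ le]]].
(* The output of [solve] does not depend on the competitor, so both applications of [H] speak of the
   same candidate. *)
have c'E : c' = c by have := congr1 (head c) E'; rewrite E.
rewrite {}c'E in le.
rewrite -(@ler_pM2l _ k%:R) ?ltr0n //.
have {}le : (k%:R * (total_retrieval G [set x in cM c] [set x in cF c])%:R <=
    (k%:R + 1) * (total_retrieval G M F)%:R :> R)%R.
  by rewrite -natrM natr1 -natrM ler_nat.
apply: le_trans le _; rewrite mulrA ler_wpM2r ?ler0n // mulrDr mulr1 lerD2l //.
Qed.

Theorem theorem10 (R : realType) :
  exists P : {poly {poly R}},
  forall eps : R, 0 < eps ->
  exists A : program,
  forall (n : nat) (G : version_graph 'I_n) (S : nat),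
    bidirectional_tree G ->
  exists (w : value) (t : nat),
    [/\ runs A (enc_instance G S) w t,
        t%:R <= P.[n%:R, eps^-1] &
        approximates eps G S w].
Proof.
(* The 2 pays for the initial call and for reading its argument. *)
have [C [d Ht]] : poly_bounded (fun n k => 2 + t_main k n)%N.
  exact: poly_boundedD (poly_bounded_const 2) t_main_poly.
(* The variables stand for [n] and [eps^-1]; the summand 2 covers the successor in [(n + k).+1] and
   the rounding up in [k]. *)
exists ((C%:R)%:P%:P * ('X + ('X)%:P + 2%:R%:P%:P) ^+ d) => eps eps0.
pose k := (Num.truncn eps^-1).+1.
have /andP[k_le k_gt] := truncn_itv (ltW (etrans (invr_gt0 eps) eps0)).
exists (prog k) => n G S G_tree.
(* A tree has a vertex, so vertex 0 exists and can serve as the root. *)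
case: n G G_tree => [|n] G G_tree; first by case: G_tree; rewrite card_ord.
have [t t_le run] := ev_main k S (erefl : ord0 = 0%N :> nat) G_tree.
exists (fptas_result k G S ord0), (1 + t).+1; split.
- by rewrite /runs; apply: ECall run => //; apply: EVar.
- rewrite !hornerE /=.
  apply: le_trans (_ : (C * (n.+1 + k).+1 ^ d)%:R <= _).
    by rewrite ler_nat (leq_trans _ (Ht n.+1 k)).
  rewrite natrM natrX ler_wpM2l ?ler0n // lerXn2r ?nnegrE ?ler0n //.
    by rewrite !addr_ge0 ?ler0n // invr_ge0 ltW.
  by rewrite -addnS natrD /k -addn2 natrD; lra.
- apply: fptas_result_approximates => //.
  by rewrite -ler_pdivrMr // mul1r ltW.
Qed.
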